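(* Let $H$ be a Hilbert space and let $Q\in\mathbb{B}(H)$ be a non-projection idempotent, with associated operator $D\in\mathbb{B}(H_5)$ as in the canonical decomposition of $Q$ described in the context. Let $T_Q=m(Q)+m(Q)Q$. Then the following statements are equivalent: (i) $W(T_Q)$ is closed in $\mathbb{C}$; (ii) $\partial\big(\overline{W(T_Q)}\big)\subseteq W(T_Q)$; (iii) there exists $z\in\partial\big(\overline{W(T_Q)}\big)$ such that $z\in W(T_Q)$; (iv) $\ell(\|D\|)\in\sigma_p\big(\ell(D)\big)$, where $\ell(D)=(D(D-I_{H_5}))^{1/2}$ and $\ell(\|D\|)=\sqrt{\|D\|(\|D\|-1)}$; (v) $\|D\|\in\sigma_p(D)$.
   Context: $H$ is a non-zero complex Hilbert space and $\mathbb{B}(H)$ the bounded operators on it. An idempotent satisfies $Q^2=Q$; a projection is a self-adjoint idempotent; a non-projection idempotent is an idempotent that is not a projection. $\mathcal{R},\mathcal{N}$ denote range and null space, $P_M$ the orthogonal projection onto a closed subspace $M$, $\sigma_p(\cdot)$ the point spectrum (set of eigenvalues), $|T|=(T^*T)^{1/2}$, $T^\dag$ the Moore-Penrose inverse. The numerical range is $W(T)=\{\langle Tx,x\rangle:x\in H,\ \|x\|=1\}$; $\overline{E}$ and $\partial E$ are the closure and boundary of $E\subseteq\mathbb{C}$. Matched projection: $m(Q)=\frac12(|Q^*|+Q^* )|Q^*|^\dag(|Q^*|+I)^{-1}(|Q^*|+Q)$, which is a projection. Canonical decomposition of a non-projection idempotent $Q$: put $H_1=\mathcal{R}(m(Q))\cap\mathcal{R}(Q)$,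 $H_4=\mathcal{N}(m(Q))\cap\mathcal{N}(Q)$, $H_5=\overline{\mathcal{R}(m(Q)Q(I-m(Q)))}$, $H_6=\overline{\mathcal{R}((I-m(Q))Qm(Q))}$ (some of $H_1,H_4$ may be zero). These are mutually orthogonal with $m(Q)=P_{H_1}+P_{H_5}$ and $I-m(Q)=P_{H_4}+P_{H_6}$, and $U_{m(Q),Q}:H\to H_1\oplus H_4\oplus H_5\oplus H_6$, $x\mapsto(P_{H_1}x,P_{H_4}x,P_{H_5}x,P_{H_6}x)^T$, is unitary. It is known that there are a unitary $U\in\mathbb{B}(H_5,H_6)$ and an operator $D\in\mathbb{B}(H_5)$ with $D\ge I_{H_5}$ and $\mathcal{N}(D-I_{H_5})=\{0\}$ such that, with $\ell(D)=(D(D-I_{H_5}))^{1/2}$, $$U_{m(Q),Q}\,Q\,U_{m(Q),Q}^*=I_{H_1}\oplus 0_{H_4}\oplus\begin{pmatrix}D&-\ell(D)U^*\\ U\ell(D)&U(I_{H_5}-D)U^*\end{pmatrix}.$$ Set $V_Q=(I_{H_1}\oplus I_{H_4}\oplus I_{H_5}\oplus U^* )U_{m(Q),Q}$. Then $$m(Q)=V_Q^*\big(I_{H_1}\oplus0_{H_4}\oplus I_{H_5}\oplus0_{H_5}\big)V_Q,\qquad Q=V_Q^*\big(I_{H_1}\oplus0_{H_4}\oplus\widetilde{Q}\big)V_Q,\qquad \widetilde{Q}=\begin{pmatrix}D&-\ell(D)\\ \ell(D)&I_{H_5}-D\end{pmatrix}.$$ *)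

(* Defs.v *)
From HB Require Import structures.
From mathcomp Require Import all_boot all_order all_algebra.
From mathcomp Require Import sesquilinear complex.
From mathcomp Require Import boolp classical_sets functions reals.
From mathcomp Require Import topology normedtype.

Set Implicit Arguments.
Unset Strict Implicit.
Unset Printing Implicit Defensive.

Import Order.TTheory GRing.Theory Num.Theory.
Import numFieldNormedType.Exports.

Local Open Scope classical_set_scope.
Local Open Scope complex_scope.
Local Open Scope ring_scope.

Reserved Notation "{ 'bounded' H -> K }"
  (at level 0, H at level 98, K at level 99, format "{ 'bounded'  H  ->  K }").
Reserved Notation "T ^†" (at level 1, format "T ^†").
Reserved Notation "T ^adj" (at level 1, format "T ^adj").

(* The topology of the field R[i] is the one of the norm. *)
HB.instance Definition _ (R : realType) := NormedModule.copy R[i] R[i]^o.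

(* The library takes norms in the scalar field, so `|x| : R[i] is a
   nonnegative complex number. The inner product is linear in its first
   argument and conjugate linear in its second one. *)
HB.mixin Record CompleteNormedModule_isHilbert (R : realType) H
    of CompleteNormedModule R[i] H := {
  inner_subdef : {dot H for (Num.conj : R[i] -> R[i])} ;
  inner_norm_subproof : forall x : H, `|x| ^+ 2 = inner_subdef x x }.

#[short(type="hilbertType")]
HB.structure Definition Hilbert (R : realType) :=
  { H of CompleteNormedModule R[i] H & CompleteNormedModule_isHilbert R H }.

Definition inner (R : realType) (H : hilbertType R) :
  {dot H for (Num.conj : R[i] -> R[i])} := inner_subdef.
Arguments inner {R H}.

Lemma normH2 (R : realType) (H : hilbertType R) (x : H) :
  `|x| ^+ 2 = inner x x.
Proof. exact: inner_norm_subproof. Qed.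

HB.mixin Record isBoundedOperator (R : realType) (H K : hilbertType R)
    (f : H -> K) := {
  operator_bounded : exists M : R[i], forall x, `|f x| <= M * `|x| }.

HB.structure Definition BoundedOperator (R : realType) (H K : hilbertType R) :=
  { f of @GRing.Linear R[i] H K *:%R f & isBoundedOperator R H K f }.

Notation "{ 'bounded' H -> K }" := (@BoundedOperator.type _ H%type K%type)
  : type_scope.

HB.instance Definition _ (R : realType) (H K : hilbertType R) :=
  gen_eqMixin {bounded H -> K}.
HB.instance Definition _ (R : realType) (H K : hilbertType R) :=
  gen_choiceMixin {bounded H -> K}.

Section bounded_instances.
Variable R : realType.
Implicit Types H K L : hilbertType R.

Let null_bounded H K :
  exists M : R[i], forall x : H, `|(\0 : H -> K) x| <= M * `|x|.
Proof. by exists 0 => x; rewrite mul0r normr0. Qed.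
HB.instance Definition _ H K :=
  isBoundedOperator.Build R H K (\0 : H -> K) (null_bounded H K).

Let id_bounded H : exists M : R[i], forall x : H, `|idfun x| <= M * `|x|.
Proof. by exists 1 => x; rewrite mul1r. Qed.
HB.instance Definition _ H :=
  isBoundedOperator.Build R H H (@idfun H) (id_bounded H).

Let add_bounded H K (f g : {bounded H -> K}) :
  exists M : R[i], forall x, `|(f \+ g) x| <= M * `|x|.
Proof.
have [M Mf] := @operator_bounded _ _ _ f.
have [N Ng] := @operator_bounded _ _ _ g.
exists (M + N) => x /=; rewrite mulrDl (le_trans (ler_normD _ _))//.
exact: lerD.
Qed.
HB.instance Definition _ H K (f g : {bounded H -> K}) :=
  isBoundedOperator.Build R H K (f \+ g) (add_bounded f g).

Let sub_bounded H K (f g : {bounded H -> K}) :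
  exists M : R[i], forall x, `|(f \- g) x| <= M * `|x|.
Proof.
have [M Mf] := @operator_bounded _ _ _ f.
have [N Ng] := @operator_bounded _ _ _ g.
exists (M + N) => x /=; rewrite mulrDl (le_trans (ler_normB _ _))//.
exact: lerD.
Qed.
HB.instance Definition _ H K (f g : {bounded H -> K}) :=
  isBoundedOperator.Build R H K (f \- g) (sub_bounded f g).

Let scale_bounded H K (a : R[i]) (f : {bounded H -> K}) :
  exists M : R[i], forall x, `|(a \*: f) x| <= M * `|x|.
Proof.
have [M Mf] := @operator_bounded _ _ _ f.
by exists (`|a| * M) => x /=; rewrite normrZ -mulrA ler_wpM2l.
Qed.
HB.instance Definition _ H K (a : R[i]) (f : {bounded H -> K}) :=
  isBoundedOperator.Build R H K (a \*: f) (scale_bounded a f).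

Let comp_bounded H K L (f : {bounded K -> L}) (g : {bounded H -> K}) :
  exists M : R[i], forall x, `|(f \o g) x| <= M * `|x|.
Proof.
have [M Mf] := @operator_bounded _ _ _ f.
have [N Ng] := @operator_bounded _ _ _ g.
exists (`|M| * N) => x /=; rewrite (le_trans (Mf _))//.
rewrite (@le_trans _ _ (`|M| * `|g x|))//; last first.
  by rewrite -mulrA ler_wpM2l.
rewrite -[leLHS]ger0_norm ?normrM ?normr_id//.
by rewrite (le_trans _ (Mf _)).
Qed.
HB.instance Definition _ H K L (f : {bounded K -> L}) (g : {bounded H -> K}) :=
  isBoundedOperator.Build R H L (f \o g) (comp_bounded f g).

End bounded_instances.

Section closed_subspaces.
Variable R : realType.

Record closed_subspace (H : hilbertType R) := ClosedSubspace {
  cs_set :> set H ;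
  cs_submod : submod_closed [pred x | x \in cs_set] ;
  cs_closed : closed cs_set }.

Variables (H : hilbertType R) (M : closed_subspace H).

Definition cs_pred : {pred H} := [pred x | x \in (M : set H)].

HB.instance Definition _ :=
  GRing.isSubmodClosed.Build R[i] H cs_pred (cs_submod M).

Record cs_type := CsType { cs_val : H ; cs_valP : cs_val \in cs_pred }.

HB.instance Definition _ := [isSub for cs_val].
HB.instance Definition _ := [Choice of cs_type by <:].
HB.instance Definition _ := [SubChoice_isSubLmodule of cs_type by <:].

Let cs_norm (x : cs_type) : R[i] := `|cs_val x|.

Let cs_normD x y : cs_norm (x + y) <= cs_norm x + cs_norm y.
Proof. exact: ler_normD. Qed.

Let cs_normZ (l : R[i]) x : cs_norm (l *: x) = `|l| * cs_norm x.
Proof. exact: normrZ. Qed.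

Let cs_norm_eq0 x : cs_norm x = 0 -> x = 0.
Proof. by move=> /normr0_eq0 x0; apply: val_inj. Qed.

HB.instance Definition _ :=
  Lmodule_isNormed.Build R[i] cs_type cs_normD cs_normZ cs_norm_eq0.

Lemma cs_normE (x : cs_type) : `|x| = `|cs_val x|.
Proof. by []. Qed.

Lemma cs_complete (F : set_system cs_type) :
  ProperFilter F -> cauchy F -> cvg F.
Proof.
move=> FF /cauchyP Fc; apply/cvg_ex => /=.
have cG : cauchy (cs_val @ F).
  apply/cauchyP => e e0; have [x Fx] := Fc e e0; exists (cs_val x).
  suff : F [set y | ball (cs_val x) e (cs_val y)] by [].
  apply: filterS Fx => y.
  by rewrite -!ball_normE.
have cvG : cvg (cs_val @ F) by exact: cauchy_cvg.
set l := lim (cs_val @ F).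
have Ml : l \in cs_pred.
  rewrite /cs_pred inE; apply: (closed_cvg (u_ := cs_val)) cvG => //.
    exact: cs_closed.
  by near=> x; have := cs_valP x; rewrite /cs_pred inE.
exists (CsType Ml); apply/cvgrPdist_lt => e e0.
by move/cvgrPdist_lt : cvG => /(_ e e0).
Unshelve. all: by end_near. Qed.

HB.instance Definition _ := Uniform_isComplete.Build cs_type cs_complete.

Definition cs_inner (x y : cs_type) : R[i] := inner (cs_val x) (cs_val y).

Let cs_inner_bilinear : bilinear_for ( *%R : R[i] -> R[i] -> R[i])
  ((Num.conj : R[i] -> R[i]) \; *%R) cs_inner.
Proof.
split=> [z a x y|z a x y]; first exact: linearPl.
exact: linearPr.
Qed.
HB.instance Definition _ := bilinear_isBilinear.Build R[i] cs_type cs_type R[i]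
  *%R (Num.conj \; *%R) cs_inner cs_inner_bilinear.

Let cs_inner_hermitian (x y : cs_type) :
  cs_inner x y = (-1) ^+ false * (cs_inner y x)^*%R.
Proof. exact: hermC. Qed.
HB.instance Definition _ := isHermitianSesquilinear.Build R[i] cs_type false
  (Num.conj : R[i] -> R[i]) cs_inner cs_inner_hermitian.

Let cs_inner_gt0 (x : cs_type) : x != 0 -> 0 < cs_inner x x.
Proof.
by move=> x0; rewrite /cs_inner -normH2 exprn_gt0// -cs_normE normr_gt0.
Qed.
HB.instance Definition _ := isDotProduct.Build R[i] cs_type cs_inner cs_inner_gt0.

Let cs_norm_inner (x : cs_type) :
  `|x| ^+ 2 = (cs_inner : {dot cs_type for (Num.conj : R[i] -> R[i])}) x x.
Proof. exact: normH2. Qed.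
HB.instance Definition _ :=
  CompleteNormedModule_isHilbert.Build R cs_type cs_norm_inner.

End closed_subspaces.

Section closed_range.
Variables (R : realType) (H K : hilbertType R) (T : {bounded H -> K}).

Local Notation ranT := (closure (range T)).

Let ranTP (y : K) :
  ranT y <-> forall e : R[i], 0 < e -> exists x, `|y - T x| < e.
Proof.
split=> [cy e e0|h B /nbhs_ballP[e /= e0 yeB]].
  have [_ [[x _ <-]]] := cy _ (nbhsx_ballx y e e0).
  by rewrite -ball_normE => ?; exists x.
have [x yx] := h e e0; exists (T x); split; first by exists x.
by apply: yeB; rewrite -ball_normE.
Qed.

Let ranT_submod : submod_closed [pred y | y \in ranT].
Proof.
split.
  by rewrite inE; apply/ranTP => e e0; exists 0; rewrite linear0 subrr normr0.
move=> a y z; rewrite !inE => /ranTP hy /ranTP hz; apply/ranTP => e e0.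
have a0 : 0 < `|a| + 1 by rewrite ltr_wpDl.
have e20 : 0 < e / 2 by rewrite divr_gt0.
have [u yu] := hy _ (divr_gt0 e20 a0); have [v zv] := hz _ e20.
exists (a *: u + v); rewrite linearP opprD addrACA -scalerBr.
rewrite (le_lt_trans (ler_normD _ _))// [ltRHS]splitr ler_ltD// normrZ.
rewrite (le_trans (ler_wpM2l _ (ltW yu)))// mulrCA ler_piMr ?(ltW e20)//.
by rewrite ler_pdivrMr// mul1r lerDl.
Qed.

Definition closed_range : closed_subspace K :=
  ClosedSubspace ranT_submod (@closed_closure _ _).

End closed_range.

(* The vector x of M as an element of the Hilbert space M. *)
Definition corestrict (R : realType) (H : hilbertType R)
  (M : closed_subspace H) (x : H) : cs_type M := insubd 0 x.

Section operators.
Variable R : realType.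
Implicit Types H K : hilbertType R.

(* The operators below that are defined by a characterization are picked
   with [xget]; the default value 0 is irrelevant whenever they exist. *)
Definition adjoint H K (T : {bounded H -> K}) : {bounded K -> H} :=
  xget (\0 : {bounded K -> H})
    [set S : {bounded K -> H} | forall x y, inner (T x) y = inner x (S y)].

Local Notation "T ^adj" := (adjoint T).

(* 0 <= z in R[i] entails that z is real, so a positive operator is
   self-adjoint. *)
Definition positive_op H (T : {bounded H -> H}) :=
  forall x, 0 <= inner (T x) x.

Definition op_sqrt H (T : {bounded H -> H}) : {bounded H -> H} :=
  xget (\0 : {bounded H -> H})
    [set S : {bounded H -> H} | positive_op S /\ S \o S =1 T].

Definition op_abs H K (T : {bounded H -> K}) : {bounded H -> H} :=
  op_sqrt (T^adj \o T).

Definition op_inv H (T : {bounded H -> H}) : {bounded H -> H} :=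
  xget (\0 : {bounded H -> H})
    [set S : {bounded H -> H} | S \o T =1 idfun /\ T \o S =1 idfun].

Definition moore_penrose H K (T : {bounded H -> K}) : {bounded K -> H} :=
  xget (\0 : {bounded K -> H})
    [set X : {bounded K -> H} |
      [/\ T \o X \o T =1 T, X \o T \o X =1 X,
          (T \o X)^adj =1 T \o X & (X \o T)^adj =1 X \o T]].

Local Notation "T ^†" := (moore_penrose T).

Definition op_idempotent H (Q : {bounded H -> H}) := Q \o Q =1 Q.

Definition is_projection H (P : {bounded H -> H}) :=
  op_idempotent P /\ P^adj =1 P.

Definition unitary H K (U : {bounded H -> K}) :=
  U^adj \o U =1 idfun /\ U \o U^adj =1 idfun.

Definition orth_proj H (M : set H) : {bounded H -> H} :=
  xget (\0 : {bounded H -> H})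
    [set P : {bounded H -> H} |
      forall x, M (P x) /\ forall y, M y -> inner (x - P x) y = 0].

Definition opnorm H K (T : {bounded H -> K}) : R :=
  sup [set complex.Re `|T x| | x in [set x : H | `|x| <= 1]].

Definition point_spectrum H (T : {bounded H -> H}) : set R[i] :=
  [set z | exists2 x : H, x != 0 & T x = z *: x].

Definition numerical_range H (T : {bounded H -> H}) : set R[i] :=
  [set inner (T x) x | x in [set x : H | `|x| = 1]].

Definition boundary (T : topologicalType) (E : set T) : set T :=
  closure E `\` E°.

Definition ell H (D : {bounded H -> H}) : {bounded H -> H} :=
  op_sqrt (D \o (D \- idfun)).

Definition ell_num (t : R) : R := Num.sqrt (t * (t - 1)).

End operators.

Notation "T ^adj" := (adjoint T) : ring_scope.
Notation "T ^†" := (moore_penrose T) : ring_scope.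

Section matched_projection.
Variables (R : realType) (H : hilbertType R) (Q : {bounded H -> H}).

Definition matched_proj : {bounded H -> H} :=
  let absQs := op_abs Q^adj in
  2^-1 \*: ((absQs \+ Q^adj) \o absQs^† \o op_inv (absQs \+ idfun)
           \o (absQs \+ Q)).

Definition H1 : set H := range matched_proj `&` range Q.

Definition H4 : set H := [set x | matched_proj x = 0] `&` [set x | Q x = 0].

Definition H5 : closed_subspace H :=
  closed_range (matched_proj \o Q \o (idfun \- matched_proj)).

Definition H6 : closed_subspace H :=
  closed_range ((idfun \- matched_proj) \o Q \o matched_proj).

(* H1 and H4 are kept as sets of vectors of H: the first two components of
   an element of H1 (+) H4 (+) H5 (+) H6 are vectors of H. *)
Definition canonical_map (x : H) : H * H * cs_type H5 * cs_type H6 :=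
  (orth_proj H1 x, orth_proj H4 x, corestrict H5 (orth_proj H5 x),
   corestrict H6 (orth_proj H6 x)).

Definition canonical_map_adj (v : H * H * cs_type H5 * cs_type H6) : H :=
  let: (x1, x4, x5, x6) := v in x1 + x4 + cs_val x5 + cs_val x6.

Definition canonical_block (U : {bounded cs_type H5 -> cs_type H6})
    (D : {bounded cs_type H5 -> cs_type H5})
    (v : H * H * cs_type H5 * cs_type H6) :
    H * H * cs_type H5 * cs_type H6 :=
  let: (x1, x4, x5, x6) := v in
  (x1, 0, D x5 - ell D (U^adj x6),
   U (ell D x5) + U ((idfun \- D) (U^adj x6))).

Record canonical_decomposition (U : {bounded cs_type H5 -> cs_type H6})
    (D : {bounded cs_type H5 -> cs_type H5}) : Prop := {
  cd_unitary : unitary U ;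
  cd_ge1 : positive_op (D \- idfun) ;
  cd_ker : [set x | (D \- idfun) x = 0] = [set 0] ;
  cd_block : forall v, H1 v.1.1.1 -> H4 v.1.1.2 ->
    canonical_map (Q (canonical_map_adj v)) = canonical_block U D v }.

End matched_projection.

(* Main.v *)
Require Import Defs.
From HB Require Import structures.
From mathcomp Require Import all_boot all_order all_algebra.
From mathcomp Require Import sesquilinear complex.
From mathcomp Require Import boolp classical_sets functions reals.
From mathcomp Require Import topology normedtype.
From mathcomp Require Import ring lra.

Set Implicit Arguments.
Unset Strict Implicit.
Unset Printing Implicit Defensive.

Import Order.TTheory GRing.Theory Num.Theory.
Import numFieldNormedType.Exports.

Local Open Scope classical_set_scope.
Local Open Scope complex_scope.
Local Open Scope ring_scope.

(* Write [m], [A] for [m(Q)], [Q^*], and [W] for [|Q^*|]. From [W A = W = Q W]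
   and [W^2 = Q A] one gets [2 Q m = W + Q] and [2 m W = W + A], so [m] is a
   projection and [Q^* = (2 m - 1) Q (2 m - 1)]; hence [x] is the sum of its
   components in H1, H4, H5, H6, and
     <TQ x, x> = 2 |x1|^2 + <(1 + D) x5, x5> - <ell(D) U^* x6, x5>.
   With [s = |D| > 1], let [E] be the closed elliptical disc of the [z] for which
   |z - (1 + s) p|^2 <= s (s - 1) p (1 - p) for some [p], that is, the
   numerical range of [[1 + s, - ell(s)], [0, 0]]. For a unit
   vector [x], [ell(D)^2 = D^2 - D <= (s - 1) D] and Cauchy-Schwarz put
   <TQ x, x> in the interior of [E] unless [D x5 = s x5], [x5 <> 0].
   Conversely, compressing to the plane of a unit [e] in H5 and
   [U ell(D) e], with <D e, e> close to [s], covers the interior of [E], and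
   all of [E] if [D e = s e].  So the numerical range is [E] or its interior
   according to whether [s] is an eigenvalue of [D]. *)

(** * Real inner product and Riesz representation *)

Section real_inner_product.
Variables (R : realType) (H : hilbertType R).
Implicit Types x y z : H.

(** Inequalities are proved for this real inner product. Since [Im <x, y> = rdot x (i y)], complex
    identities follow by testing against [i y] as well. *)
Definition rdot x y : R := complex.Re (inner x y).
Definition nrm x : R := complex.Re `|x|.

Lemma norm_nrm x : `|x| = (nrm x)%:C.
Proof. by rewrite /nrm RRe_real// ger0_real. Qed.

Lemma nrm_ge0 x : 0 <= nrm x.
Proof. by rewrite -ler0c -norm_nrm. Qed.

Lemma nrm0 : nrm 0 = 0.
Proof. by rewrite /nrm normr0. Qed.

Lemma nrm_eq0 x : nrm x = 0 -> x = 0.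
Proof. by move=> x0; apply: normr0_eq0; rewrite norm_nrm x0. Qed.

Lemma nrm_gt0 x : x != 0 -> 0 < nrm x.
Proof. by rewrite -ltcR -norm_nrm normr_gt0. Qed.

Lemma nrmD x y : nrm (x + y) <= nrm x + nrm y.
Proof. by rewrite -lecR rmorphD/= -!norm_nrm ler_normD. Qed.

Lemma nrmN x : nrm (- x) = nrm x.
Proof. by rewrite /nrm normrN. Qed.

Lemma nrmB x y : nrm (x - y) <= nrm x + nrm y.
Proof. by rewrite -(nrmN y) nrmD. Qed.

Lemma nrm_distC x y : nrm (x - y) = nrm (y - x).
Proof. by rewrite -nrmN opprB. Qed.

Lemma nrmZ (a : R) x : nrm (a%:C *: x) = `|a| * nrm x.
Proof.
apply: (@complexI R); rewrite -norm_nrm normrZ rmorphM/= -norm_nrm.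
by congr (_ * _); rewrite normc_def /= expr0n addr0 sqrtr_sqr.
Qed.

Lemma innerDl x y z : inner (x + y) z = inner x z + inner y z.
Proof. exact: linearDl. Qed.
Lemma innerDr x y z : inner x (y + z) = inner x y + inner x z.
Proof. exact: linearDr. Qed.
Lemma innerNl x y : inner (- x) y = - inner x y.
Proof. exact: linearNl. Qed.
Lemma innerZl a x y : inner (a *: x) y = a * inner x y.
Proof. exact: linearZl_LR. Qed.
Lemma innerZr (a : R) x y : inner x (a%:C *: y) = a%:C * inner x y.
Proof.
rewrite [LHS]linearZr_LR /=; congr (_ * _).
by apply/CrealP; rewrite complex_real.
Qed.

Lemma inner_rdot x : inner x x = (nrm x ^+ 2)%:C.
Proof. by rewrite -normH2 norm_nrm rmorphXn. Qed.

Lemma rdotxx x : rdot x x = nrm x ^+ 2.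
Proof. by rewrite /rdot inner_rdot. Qed.

Lemma rdotC x y : rdot x y = rdot y x.
Proof.
rewrite /rdot hermC expr0 mul1r -/(Num.conj _).
by apply: (@complexI R); rewrite !complexRe Re_conj.
Qed.

Lemma rdotDl x y z : rdot (x + y) z = rdot x z + rdot y z.
Proof. by rewrite /rdot linearDl raddfD. Qed.

Lemma rdotNl x z : rdot (- x) z = - rdot x z.
Proof. by rewrite /rdot linearNl raddfN. Qed.

Lemma rdotBl x y z : rdot (x - y) z = rdot x z - rdot y z.
Proof. by rewrite rdotDl rdotNl. Qed.

Lemma rdotDr x y z : rdot x (y + z) = rdot x y + rdot x z.
Proof. by rewrite ![rdot x _]rdotC rdotDl. Qed.

Lemma rdotNr x z : rdot x (- z) = - rdot x z.
Proof. by rewrite ![rdot x _]rdotC rdotNl. Qed.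

Lemma rdotBr x y z : rdot x (y - z) = rdot x y - rdot x z.
Proof. by rewrite rdotDr rdotNr. Qed.

Lemma rdotZl (a : R) x y : rdot (a%:C *: x) y = a * rdot x y.
Proof.
rewrite /rdot linearZl_LR /=; case: (inner x y) => u v /=.
by rewrite mul0r subr0.
Qed.

Lemma rdotZr (a : R) x y : rdot x (a%:C *: y) = a * rdot x y.
Proof. by rewrite rdotC rdotZl rdotC. Qed.

Lemma rdot0l y : rdot 0 y = 0. Proof. by rewrite /rdot linear0l. Qed.
Lemma rdot0r x : rdot x 0 = 0. Proof. by rewrite rdotC rdot0l. Qed.

Definition rdotE := (rdotDl, rdotDr, rdotNl, rdotNr, rdotZl, rdotZr).

Lemma Im_inner x y : complex.Im (inner x y) = rdot x ('i%C *: y).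
Proof.
rewrite /rdot linearZr_LR /=.
have -> : Num.conj 'i%C = - 'i%C :> R[i] by rewrite complexiE conjCi.
by case: (inner x y) => u v; rewrite /= oppr0 mul0r sub0r mulN1r opprK.
Qed.

Lemma rdotZi x y : rdot ('i%C *: x) y = - rdot x ('i%C *: y).
Proof.
by rewrite -Im_inner /rdot linearZl_LR mulrC ReiNIm.
Qed.

Lemma inner_rdotE x y : inner x y = rdot x y +i* rdot x ('i%C *: y).
Proof. by rewrite -Im_inner /rdot; case: (inner x y). Qed.

Lemma nrmZi x : nrm ('i%C *: x) = nrm x.
Proof.
by rewrite /nrm normrZ complexiE normCi mul1r.
Qed.

Lemma rdot_eq0 x : (forall y, rdot x y = 0) -> x = 0.
Proof.
by move=> /(_ x)/eqP; rewrite rdotxx sqrf_eq0 => /eqP /nrm_eq0.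
Qed.

Lemma rdot_inj x y : (forall z, rdot x z = rdot y z) -> x = y.
Proof.
by move=> h; apply/eqP; rewrite -subr_eq0; apply/eqP/rdot_eq0 => z;
  rewrite rdotBl h subrr.
Qed.

Lemma rdot_CS2 x y : rdot x y ^+ 2 <= nrm x ^+ 2 * nrm y ^+ 2.
Proof.
have [->|y0] := eqVneq y 0; first by rewrite rdot0r nrm0 !expr0n /= mulr0.
have ny : 0 < nrm y ^+ 2 by rewrite exprn_gt0// nrm_gt0.
have := sqr_ge0 (nrm ((nrm y ^+ 2)%:C *: x - (rdot x y)%:C *: y)).
rewrite -(rdotxx (_ - _)) !rdotE !rdotxx (rdotC y x) => h.
by rewrite -subr_ge0 -(pmulr_rge0 _ ny); apply: le_trans h _; lra.
Qed.

Lemma rdot_ii x : rdot x ('i%C *: x) = 0.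
Proof. by rewrite -Im_inner inner_rdot. Qed.

(** The bound is on the complex modulus. It is the real Cauchy-Schwarz inequality against
    [a y + b (i y)], where [y] and [i y] are orthogonal for [rdot] and have the same norm. *)
Lemma inner_CS x y :
  rdot x y ^+ 2 + rdot x ('i%C *: y) ^+ 2 <= nrm x ^+ 2 * nrm y ^+ 2.
Proof.
set a := rdot x y; set b := rdot x _.
have [->|ab] := eqVneq (a ^+ 2 + b ^+ 2) 0; first by rewrite mulr_ge0 ?sqr_ge0.
have ab0 : 0 < a ^+ 2 + b ^+ 2 by rewrite lt0r ab addr_ge0 ?sqr_ge0.
have := rdot_CS2 x (a%:C *: y + b%:C *: ('i%C *: y)).
rewrite -(rdotxx (_ + _)) !rdotE (rdotC ('i%C *: y) y) !rdot_ii !rdotxx nrmZi.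
rewrite -/a -/b => h.
by rewrite -(ler_pM2l ab0); apply: (le_trans (le_trans _ h)); rewrite ?exprMn; lra.
Qed.

Lemma rdot_CS x y : rdot x y <= nrm x * nrm y.
Proof.
rewrite (le_trans (ler_norm _))// -(@ler_pXn2r _ 2)// ?nnegrE ?mulr_ge0 ?nrm_ge0//.
by rewrite exprMn real_normK ?num_real// rdot_CS2.
Qed.

Lemma nrmD2 x y : nrm (x + y) ^+ 2 = nrm x ^+ 2 + 2 * rdot x y + nrm y ^+ 2.
Proof. by rewrite -!rdotxx !rdotE (rdotC y x); ring. Qed.

Lemma nrmB2 x y : nrm (x - y) ^+ 2 = nrm x ^+ 2 - 2 * rdot x y + nrm y ^+ 2.
Proof. by rewrite nrmD2 nrmN rdotNr; ring. Qed.

Lemma complete_seq (u : nat -> H) :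
  (forall e : R, 0 < e -> exists N, forall m n, (N <= m)%N -> (N <= n)%N ->
     nrm (u m - u n) < e) ->
  exists l, forall e : R, 0 < e -> exists N, forall n, (N <= n)%N ->
     nrm (l - u n) < e.
Proof.
move=> cu.
have /cauchy_cvg cvu : cauchy (u @ \oo).
  apply/cauchyP => e e0.
  have eE : e = (complex.Re e)%:C by rewrite RRe_real// gtr0_real.
  have e'0 : 0 < complex.Re e by rewrite -ltcR -eE.
  have [N uN] := cu _ e'0; exists (u N); exists N => // n /= Nn.
  by rewrite -ball_normE /= norm_nrm eE ltcR; apply: uN.
exists (lim (u @ \oo)) => e e0.
move/cvgrPdist_lt : cvu => /(_ e%:C); rewrite ltcR => /(_ e0)[N _ uN].
by exists N => n /uN /=; rewrite norm_nrm ltcR.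
Qed.

End real_inner_product.

(** Limits are taken in this form: estimate by a constant times an arbitrary [e]. The sign of [K] is
    free, whence [|K| + 1] in the proof. *)
Lemma le0_eps (R : realType) (K x : R) :
  (forall e, 0 < e -> x <= K * e) -> x <= 0.
Proof.
move=> h; rewrite leNgt; apply/negP => x0.
have K0 : 0 < `|K| + 1 by rewrite ltr_wpDl.
have e0 : 0 < x / (2 * (`|K| + 1)) by rewrite divr_gt0// mulr_gt0.
have := h _ e0; apply/negP; rewrite -ltNge.
rewrite mulrCA gtr_pMr// ltr_pdivrMr ?mulr_gt0// mul1r.
by have := ler_norm K; have := normr_ge0 K; lra.
Qed.

Lemma natSinv_lt (R : realType) (e : R) : 0 < e ->
  exists N, forall n, (N <= n)%N -> n.+1%:R^-1 < e.
Proof.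
move=> e0; exists (Num.bound e^-1) => n Nn.
rewrite invf_plt ?posrE//; apply: lt_le_trans (archi_boundP _) _.
  by rewrite invr_ge0 ltW.
by rewrite ler_nat leqW.
Qed.

Section riesz.
Variables (R : realType) (H : hilbertType R).

(* Minimise [|y|^2 / 2 - f y] over the subspace [M]; the parallelogram law
   makes minimising sequences Cauchy. *)
Lemma riesz_subspace (M : set H) (f : H -> R) (C : R) :
  M 0 -> (forall a y z, M y -> M z -> M (a%:C *: y + z)) ->
  (forall a y z, f (a%:C *: y + z) = a * f y + f z) ->
  (forall y, f y <= C * nrm y) ->
  exists2 z, (forall e, 0 < e -> exists2 y, M y & nrm (z - y) < e) &
             forall y, M y -> rdot z y = f y.
Proof.
move=> M0 ML fL fC; pose phi y := nrm y ^+ 2 / 2 - f y.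
have f0 : f 0 = 0.
  by have := fL 1 0 0; rewrite scaler0 addr0; lra.
have fZ a y : f (a%:C *: y) = a * f y.
  by rewrite -[_ *: y]addr0 fL f0 addr0.
have MZ a y : M y -> M (a%:C *: y).
  by move=> My; rewrite -[_ *: y]addr0; apply: ML.
pose S := [set phi y | y in M]; pose d := inf S.
have hS : has_inf S.
  split; first by exists (phi 0), 0.
  exists (- C ^+ 2 / 2) => _ [y My <-]; rewrite /phi.
  have := fC y; have := sqr_ge0 (nrm y - C).
  by lra.
have dle y : M y -> d <= phi y.
  by move=> My; apply: ge_inf; [exact: hS.2|exists y].
have /choice[u uP] : forall n, exists y, M y /\ phi y < d + n.+1%:R^-1.
  move=> n; have [|_ [y My <-] h] := @inf_adherent _ S n.+1%:R^-1 _ hS.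
    by rewrite invr_gt0.
  by exists y.
have Mu n := (uP n).1; have phiu n := (uP n).2.
have [|z zu] := @complete_seq R H u.
  (* [|u m - u n|^2 / 4] equals [phi (u m) + phi (u n)] minus twice [phi] at the midpoint, which
     lies in [M]. With both excesses over [d] below [e^2 / 8], this is less than [e^2 / 4]. *)
  move=> e e0; have e80 : 0 < e ^+ 2 / 8 by rewrite divr_gt0// exprn_gt0.
  have [N hN] := natSinv_lt e80; exists N => m n Nm Nn.
  rewrite -(@ltr_pXn2r _ 2)// ?nnegrE ?nrm_ge0 ?(ltW e0)//.
  have := dle _ (MZ 2^-1 _ (ML 1 _ _ (Mu m) (Mu n))).
  have := phiu m; have := phiu n; have := hN _ Nm; have := hN _ Nn.
  rewrite /phi fZ fL nrmZ exprMn real_normK ?num_real// scale1r.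
  by rewrite nrmD2 nrmB2; move: n.+1%:R^-1 m.+1%:R^-1 => a b; lra.
exists z.
  by move=> e /zu[N hN]; exists (u N); [exact: Mu|exact: hN].
move=> y My; set c := rdot z y - f y; pose q := nrm y ^+ 2.
(* First variation in the direction [y]: minimality makes [t c + t^2 q / 2] nonnegative for all [t],
   and [t = - c / (q + 1)] then forces [c = 0]. The denominator stays positive when [q = 0]. *)
suff key t : - (t * c + t ^+ 2 * q / 2) <= 0.
  have q0 : 0 <= q by exact: sqr_ge0.
  have q1 : 0 < q + 1 by lra.
  have := key (- c / (q + 1)).
  have -> : - (- c / (q + 1) * c + (- c / (q + 1)) ^+ 2 * q / 2) =
            c ^+ 2 * ((q + 2) / 2 / (q + 1) ^+ 2) by field; lra.
  rewrite pmulr_lle0; last by rewrite !divr_gt0 ?exprn_gt0//; lra.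
  by rewrite exprn_even_le0//= => /eqP /subr0_eq.
apply: (@le0_eps _ (1 + `|t| * nrm y)) => e e0.
have [N1 hN1] := zu e e0; have [N2 hN2] := natSinv_lt e0.
pose n := maxn N1 N2.
have zn := hN1 n (leq_maxl _ _); have en := hN2 n (leq_maxr _ _).
have := dle _ (ML t _ _ My (Mu n)); have := phiu n.
rewrite /phi fL nrmD2 nrmZ exprMn real_normK ?num_real// rdotZl -/q => h1 h2.
have h3 : - (t * rdot y (z - u n)) <= `|t| * nrm y * e.
  rewrite (le_trans (ler_norm _))// normrN normrM -mulrA ler_wpM2l//.
  rewrite (@le_trans _ _ (nrm y * nrm (z - u n)))//; last first.
    by rewrite ler_wpM2l ?nrm_ge0// ltW.
  by rewrite ler_norml rdot_CS andbT lerNl -rdotNl -(nrmN y) rdot_CS.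
by move: h1 h2 h3 en; rewrite rdotBr /c (rdotC z); move: n.+1%:R^-1 => b; lra.
Qed.

End riesz.

(** * Bounded operators and their adjoints *)

Section bounded_operators.
Variable R : realType.
Implicit Types H K : hilbertType R.

Lemma bop0 H K (T : {bounded H -> K}) : T 0 = 0.
Proof. exact: linear0. Qed.
Lemma bopD H K (T : {bounded H -> K}) x y : T (x + y) = T x + T y.
Proof. exact: linearD. Qed.
Lemma bopB H K (T : {bounded H -> K}) x y : T (x - y) = T x - T y.
Proof. exact: linearB. Qed.
Lemma bopN H K (T : {bounded H -> K}) x : T (- x) = - T x.
Proof. exact: linearN. Qed.
Lemma bopZ H K (T : {bounded H -> K}) a x : T (a *: x) = a *: T x.
Proof. exact: linearZ. Qed.

Lemma bounded_nrm H K (T : {bounded H -> K}) :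
  exists2 M : R, 0 <= M & forall x, nrm (T x) <= M * nrm x.
Proof.
have [M hM] := @operator_bounded _ _ _ T.
exists `|complex.Re M| => // x; have := hM x.
rewrite !norm_nrm lecE => /andP[_]; case: M {hM} => a b /=.
rewrite mulr0 subr0 => h; apply: le_trans h _.
by rewrite ler_wpM2r ?nrm_ge0 ?ler_norm.
Qed.

Lemma mk_bounded H K (f : H -> K) (M : R) : linear f ->
  (forall x, nrm (f x) <= M * nrm x) -> exists T : {bounded H -> K}, T =1 f.
Proof.
move=> lf bf.
have bf' : exists M : R[i], forall x, `|f x| <= M * `|x|.
  by exists M%:C => x; rewrite !norm_nrm -rmorphM lecR.
pose L := GRing.isLinear.Build R[i] H K *:%R f lf.
pose B := isBoundedOperator.Build R H K f bf'.
by exists (HB.pack f L B : {bounded H -> K}).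
Qed.

Lemma rdot_inner H K (T : {bounded H -> K}) (S : {bounded K -> H}) :
  (forall x y, rdot (T x) y = rdot x (S y)) ->
  forall x y, inner (T x) y = inner x (S y).
Proof. by move=> h x y; rewrite !inner_rdotE !h linearZ. Qed.

(** The adjoint is a chosen operator, so one must exist: Riesz representation on the whole space,
    applied to [x |-> rdot (T x) z], provides its value at [z]. *)
Lemma adjoint_rdot H K (T : {bounded H -> K}) x y :
  rdot (T x) y = rdot x (adjoint T y).
Proof.
suff : exists S : {bounded K -> H}, forall x y, inner (T x) y = inner x (S y).
  case=> S hS; rewrite /adjoint; case: xgetP => [S' _ h|/(_ S)]; last by case.
  by rewrite /rdot h.
have [M M0 hM] := bounded_nrm T.
have /choice[f fP] (z : K) : exists w, forall x, rdot (T x) z = rdot x w.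
  have [||||w _ hw] := @riesz_subspace R H setT (fun x => rdot (T x) z) (M * nrm z).
  - by [].
  - by [].
  - by move=> a u v; rewrite linearP rdotDl rdotZl.
  - move=> u; rewrite (le_trans (rdot_CS _ _))// mulrAC ler_wpM2r ?nrm_ge0//.
  by exists w => u; rewrite [RHS]rdotC hw.
have fl : linear f.
  move=> a u v; apply: rdot_inj => t; rewrite !(rdotC _ t) rdotDr -!fP rdotDr.
  (* The representation is only real, so the scalar is split into real and imaginary parts; the
     factor [i] is moved across the real product, through [T], and back. *)
  congr (_ + _); case: a => a b.
  have -> : a +i* b = a%:C + b%:C * 'i%C by simpc.
  rewrite !scalerDl !rdotDr -!scalerA !rdotZr fP; congr (_ + b * _).
  by rewrite -[LHS]opprK -rdotZi -linearZ fP rdotZi opprK.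
have [|S hS] := mk_bounded (M := M) fl.
  move=> u; have [->|fu] := eqVneq (f u) 0; first by rewrite nrm0 mulr_ge0 ?nrm_ge0.
  rewrite -(ler_pM2r (nrm_gt0 fu)) -expr2 -rdotxx -fP.
  rewrite (le_trans (rdot_CS _ _))// mulrAC ler_wpM2r ?nrm_ge0//.
by exists S; apply: rdot_inner => u v; rewrite hS fP.
Qed.

Lemma adjoint_uniq H K (T : {bounded H -> K}) (S : {bounded K -> H}) :
  (forall x y, rdot (T x) y = rdot x (S y)) -> adjoint T =1 S.
Proof.
by move=> h y; apply: rdot_inj => x; rewrite rdotC -adjoint_rdot h rdotC.
Qed.

Lemma adjointK H K (T : {bounded H -> K}) : adjoint (adjoint T) =1 T.
Proof. by apply: adjoint_uniq => x y; rewrite rdotC -adjoint_rdot rdotC. Qed.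

(** Stability under [i] upgrades real orthogonality to complex orthogonality, so [P] qualifies for
    the choice. Two candidates differ by a vector orthogonal to [M] whose two terms lie in [M]. *)
Lemma orth_projP H (M : set H) (P : {bounded H -> H}) :
  (forall x : H, M (P x)) -> (forall x y, M y -> rdot (x - P x) y = 0) ->
  (forall y, M y -> M ('i%C *: y)) -> orth_proj M =1 P.
Proof.
move=> MP oP iM.
have h (x y : H) : M y -> inner (x - P x) y = 0.
  by move=> My; rewrite inner_rdotE !oP//; exact: iM.
rewrite /orth_proj; case: xgetP => [P' _ hP'|/(_ P)]; last first.
  by case=> x; split=> // y /h.
move=> x; apply/eqP; rewrite -subr_eq0; apply/eqP/nrm_eq0/eqP.
rewrite -sqrf_eq0 -rdotxx.
have o y : M y -> rdot (P' x - P x) y = 0.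
  move=> My; have -> : P' x - P x = (x - P x) - (x - P' x).
    by rewrite opprB [RHS]addrC addrA subrK.
  by rewrite rdotBl oP// /rdot (hP' x).2// subr0.
by rewrite rdotBr !o ?subr0//; case: (hP' x).
Qed.

End bounded_operators.

(** * Positive operators *)

Lemma discriminant_le (R : realType) (a b c : R) : 0 <= a ->
  (forall t, 0 <= a * t ^+ 2 + 2 * b * t + c) -> b ^+ 2 <= a * c.
Proof.
move=> a_ge0 h; have c0 : 0 <= c by have := h 0; rewrite expr0n mulr0 mulr0; lra.
have [a0|a0] := ltP 0 a.
  have := h (- b / a); rewrite -(pmulr_rge0 _ a0).
  have -> : a * (a * (- b / a) ^+ 2 + 2 * b * (- b / a) + c) = a * c - b ^+ 2.
    by field; lra.
  by lra.
have [->|b0] := eqVneq b 0; first by rewrite expr0n mulr_ge0.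
(* Here [a = 0], and the affine function [2 b t + c] takes the value -1 at this point. *)
have := h (- ((c + 1) / (2 * b))).
have -> : a * (- ((c + 1) / (2 * b))) ^+ 2 + 2 * b * - ((c + 1) / (2 * b)) + c =
  a * ((c + 1) / (2 * b)) ^+ 2 - 1 by field.
by have := sqr_ge0 ((c + 1) / (2 * b)); nra.
Qed.

Section positive_operators.
Variable R : realType.
Implicit Types H K : hilbertType R.

Definition symmetric_op H (T : H -> H) := forall x y, rdot (T x) y = rdot x (T y).

Lemma nrm_scale H (a : R[i]) (x : H) : nrm (a *: x) = complex.Re `|a| * nrm x.
Proof. 
apply: (@complexI R); rewrite -norm_nrm normrZ rmorphM/= -norm_nrm.
by congr (_ * _); rewrite RRe_real ?normr_real.
Qed.

Lemma eq_eps H (K : R) (x y : H) :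
  (forall e, 0 < e -> nrm (x - y) <= K * e) -> x = y.
Proof.
move=> /le0_eps h; apply/subr0_eq/nrm_eq0/eqP.
by rewrite eq_le h nrm_ge0.
Qed.

(** Polarization: the form [<T z, z>] is real, and its imaginary part at [z = x + i y] is the defect
    of symmetry. *)
Lemma positive_op_sym H (T : {bounded H -> H}) : positive_op T -> symmetric_op T.
Proof.
move=> pT; have im x : rdot (T x) ('i%C *: x) = 0.
  by have := pT x; rewrite inner_rdotE lecE => /andP[/eqP].
move=> x y; have := im (x + 'i%C *: y).
have ii (z : H) : 'i%C *: ('i%C *: z) = - z.
  by rewrite scalerA -expr2 sqr_i scaleN1r.
rewrite linearD scalerDr !(rdotDl, rdotDr) !im ii rdotNr linearZ rdotZi ii rdotNr.
by rewrite (rdotC x); lra.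
Qed.

Lemma positive_op_ge0 H (T : {bounded H -> H}) x : positive_op T -> 0 <= rdot (T x) x.
Proof. by move=> /(_ x); rewrite lecE => /andP[]. Qed.

Lemma sym_ge0_positive H (T : {bounded H -> H}) : symmetric_op T ->
  (forall x, 0 <= rdot (T x) x) -> positive_op T.
Proof.
move=> sT pT x; rewrite inner_rdotE lecE pT andbT; apply/eqP => /=.
have := sT x ('i%C *: x); rewrite linearZ.
by rewrite (rdotC x) rdotZi/=; lra.
Qed.

Lemma positive_op_CS H (T : {bounded H -> H}) x y : positive_op T ->
  rdot (T x) y ^+ 2 <= rdot (T x) x * rdot (T y) y.
Proof.
move=> pT; rewrite mulrC; apply: discriminant_le => [|t]; first exact: positive_op_ge0.
have := positive_op_ge0 (x + t%:C *: y) pT.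
rewrite linearD linearZ/= !rdotE (positive_op_sym pT y x) (rdotC y).
by move=> h; apply: (le_trans h); lra.
Qed.

(** Cauchy-Schwarz for the form of [T] at [x] and [T x], then division by [|T x|^2]. For [D] this
    gives [|D x|^2 <= s <D x, x>]. *)
Lemma positive_op_nrm H (T : {bounded H -> H}) (M : R) : positive_op T ->
  (forall x, rdot (T x) x <= M * nrm x ^+ 2) ->
  forall x, nrm (T x) ^+ 2 <= M * rdot (T x) x.
Proof.
move=> pT hM x; have := positive_op_CS x (T x) pT; rewrite rdotxx => h.
have [->|Tx] := eqVneq (T x) 0; first by rewrite nrm0 rdot0l expr0n mulr0.
have n0 : 0 < nrm (T x) ^+ 2 by rewrite exprn_gt0// nrm_gt0.
rewrite -(ler_pM2r n0) -expr2 (le_trans h)//.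
by rewrite [leRHS]mulrAC [leRHS]mulrC ler_wpM2l ?positive_op_ge0.
Qed.

Lemma positive_op_eq0 H (T : {bounded H -> H}) x : positive_op T ->
  rdot (T x) x = 0 -> T x = 0.
Proof.
move=> pT Tx; have := positive_op_CS x (T x) pT; rewrite Tx mul0r rdotxx => h.
by apply/nrm_eq0/eqP; rewrite -sqrf_eq0 -sqrf_eq0 eq_le h sqr_ge0.
Qed.

Lemma positive_op_addc_inj H (T : {bounded H -> H}) (c : R) x : positive_op T ->
  0 < c -> T x + c%:C *: x = 0 -> x = 0.
Proof.
move=> pT c0 Tx; have := rdot0l x; rewrite -{1}Tx rdotDl rdotZl rdotxx => h.
apply/nrm_eq0/eqP; rewrite -sqrf_eq0; apply/eqP.
by have := positive_op_ge0 x pT; have := sqr_ge0 (nrm x); nra.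
Qed.

(** A Lax-Milgram argument: coercivity bounds [T] from below, so sequences with Cauchy images are
    Cauchy, and it also makes the range dense. *)
Lemma coercive_inv H (T : {bounded H -> H}) (c : R) : 0 < c ->
  (forall x, c * nrm x ^+ 2 <= rdot (T x) x) ->
  exists S : {bounded H -> H}, S \o T =1 idfun /\ T \o S =1 idfun.
Proof.
move=> c0 cT; have [M M0 hM] := bounded_nrm T.
have cn x : c * nrm x <= nrm (T x).
  have [->|x0] := eqVneq x 0; first by rewrite nrm0 mulr0 nrm_ge0.
  rewrite -(ler_pM2r (nrm_gt0 x0)) -mulrA -expr2.
  exact: le_trans (cT x) (rdot_CS _ _).
have cn' x : nrm x <= c^-1 * nrm (T x) by rewrite mulrC ler_pdivlMr// mulrC.
have injT x y : T x = T y -> x = y.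
  move=> xy; apply/subr0_eq/nrm_eq0/eqP; rewrite eq_le nrm_ge0 andbT.
  by rewrite (le_trans (cn' _))// bopB xy subrr nrm0 mulr0.
have /choice[S TS] x : exists u, T u = x.
  have [||||z cz oz] := @riesz_subspace R H (range T) (rdot x) (nrm x).
  - by exists 0; rewrite ?bop0.
  - by move=> a _ _ [u _ <-] [v _ <-]; exists (a%:C *: u + v); rewrite ?bopD ?bopZ.
  - by move=> a u v; rewrite rdotDr rdotZr.
  - by move=> u; exact: rdot_CS.
  (* [z] is the projection of [x] on the closure of the range. So [z - x] is orthogonal to the
     range, in particular to [T (z - x)], and coercivity gives [z = x]. *)
  have zx : z = x.
    apply/subr0_eq/nrm_eq0/eqP; rewrite -sqrf_eq0 -(mulrI_eq0 _ (lregP (lt0r_neq0 c0))).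
    rewrite eq_le; apply/andP; split; last by rewrite mulr_ge0 ?sqr_ge0// ltW.
    by rewrite (le_trans (cT _))// rdotC rdotBl oz ?subrr//; exists (z - x).
  rewrite {}zx in cz oz.
  have /choice[v hv] n : exists v, nrm (x - T v) < n.+1%:R^-1.
    have [|_ [v _ <-] h] := cz n.+1%:R^-1; first by rewrite invr_gt0.
    by exists v.
  have [|u vu] := @complete_seq R H v.
    move=> e e0; have e20 : 0 < c * e / 2 by rewrite divr_gt0// mulr_gt0.
    have [N hN] := natSinv_lt e20; exists N => m n Nm Nn.
    rewrite (le_lt_trans (cn' _))// mulrC ltr_pdivrMr// mulrC bopB.
    rewrite (_ : T _ - T _ = (x - T (v n)) - (x - T (v m))); last first.
      by rewrite opprB [RHS]addrC addrA subrK.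
    rewrite (le_lt_trans (nrmB _ _))//.
    by have := lt_trans (hv m) (hN _ Nm); have := lt_trans (hv n) (hN _ Nn); lra.
  exists u; apply/esym/(@eq_eps _ (1 + M)) => e e0.
  have [N1 hN1] := vu e e0; have [N2 hN2] := natSinv_lt e0.
  pose n := maxn N1 N2.
  have un := hN1 n (leq_maxl _ _); have en := hN2 n (leq_maxr _ _).
  rewrite (_ : x - T u = (x - T (v n)) - T (u - v n)); last first.
    by rewrite bopB opprB addrA subrK.
  rewrite (le_trans (nrmB _ _))// mulrDl mul1r lerD//.
    by rewrite ltW// (lt_trans _ en).
  by rewrite (le_trans (hM _))// ler_wpM2l// ltW.
have Sl : linear S by move=> a x y; apply: injT; rewrite bopD bopZ !TS.
have [|S' hS'] := mk_bounded (M := c^-1) Sl.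
  by move=> x; rewrite (le_trans (cn' _))// TS.
by exists S'; split=> x /=; rewrite hS' ?TS//; apply: injT; rewrite TS.
Qed.

Lemma bounded_positive_bound H (T : {bounded H -> H}) : positive_op T ->
  exists2 M : R, 0 < M & forall x, nrm (T x) ^+ 2 <= M * rdot (T x) x.
Proof.
move=> pT; have [M M0 hM] := bounded_nrm T; exists (M + 1); first by lra.
apply: positive_op_nrm => // x; rewrite (le_trans (rdot_CS _ _))//.
rewrite expr2 mulrA ler_wpM2r ?nrm_ge0// (le_trans (hM _))//.
by rewrite ler_wpM2r ?nrm_ge0// lerDl.
Qed.

End positive_operators.

(** * Square roots of positive operators *)

Section square_root.
Variables (R : realType) (H : hilbertType R) (B : {bounded H -> H}).
Hypothesis symB : symmetric_op B.
Hypothesis contrB : forall x, nrm (B x) <= nrm x.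

Fixpoint sqrt_iter n : H -> H :=
  if n is m.+1 then
    fun x => 2^-1%:C *: (B x + sqrt_iter m (sqrt_iter m x))
  else fun=> 0.

(** The same recursion with the scalar 1 in place of [B]: a majorant for the operator iteration. *)
Fixpoint sqrt_iter_bound n : R :=
  if n is m.+1 then 2^-1 * (1 + sqrt_iter_bound m ^+ 2) else 0.

Local Notation Y := sqrt_iter.
Local Notation t := sqrt_iter_bound.

Lemma sqrt_iter_linear n : linear (Y n).
Proof.
elim: n => [|n ih] a x y /=; first by rewrite scaler0 addr0.
rewrite bopD bopZ !ih scalerA mulrC -scalerA -scalerDr; congr (_ *: _).
by rewrite scalerDr addrACA.
Qed.

Lemma sqrt_iterB n x y : Y n (x - y) = Y n x - Y n y.
Proof. by rewrite -scaleN1r addrC sqrt_iter_linear scaleN1r addrC. Qed.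

Lemma sqrt_iter_sym n : symmetric_op (Y n).
Proof.
elim: n => [|n ih] x y /=; first by rewrite rdot0l rdot0r.
by rewrite !rdotE symB !ih.
Qed.

Lemma sqrt_iter_bound01 n : 0 <= t n <= 1.
Proof. by elim: n => [|n ih] /=; nra. Qed.

Lemma sqrt_iter_bound_ge0 n : 0 <= t n.
Proof. by case/andP: (sqrt_iter_bound01 n). Qed.

Lemma sqrt_iter_boundS n : t n <= t n.+1.
Proof. by have := sqr_ge0 (t n - 1) => /=; lra. Qed.

Lemma sqrt_iter_nrm n x : nrm (Y n x) <= t n * nrm x.
Proof.
elim: n x => [|n ih] x /=; first by rewrite nrm0 mul0r.
rewrite nrmZ ger0_norm ?invr_ge0// -mulrA ler_wpM2l ?invr_ge0//.
rewrite (le_trans (nrmD _ _))// mulrDl mul1r lerD// expr2 -mulrA.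
by rewrite (le_trans (ih _))// ler_wpM2l ?sqrt_iter_bound_ge0.
Qed.

(** The increments are dominated by those of the scalar majorant. The squares are compared through
    [Y^2 - Z^2 = Y (Y - Z) + (Y - Z) Z]. *)
Lemma sqrt_iter_step n x : nrm (Y n.+1 x - Y n x) <= (t n.+1 - t n) * nrm x.
Proof.
have YS m z : Y m.+1 z = 2^-1%:C *: (B z + Y m (Y m z)) by [].
have tS m : t m.+1 = 2^-1 * (1 + t m ^+ 2) by [].
elim: n x => [|n ih] x.
  rewrite /= subr0 addr0 nrmZ ger0_norm ?invr_ge0// subr0 expr0n addr0 mulr1.
  by rewrite ler_wpM2l ?invr_ge0.
have -> : Y n.+2 x - Y n.+1 x = 2^-1%:C *:
    (Y n.+1 (Y n.+1 x - Y n x) + (Y n.+1 (Y n x) - Y n (Y n x))).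
  rewrite sqrt_iterB addrA subrK (YS n.+1) {2}(YS n x) -scalerBr; congr (_ *: _).
  by rewrite opprD addrACA subrr add0r.
rewrite nrmZ ger0_norm ?invr_ge0//.
have h1 : nrm (Y n.+1 (Y n.+1 x - Y n x)) <= t n.+1 * ((t n.+1 - t n) * nrm x).
  by rewrite (le_trans (sqrt_iter_nrm _ _))// ler_wpM2l ?sqrt_iter_bound_ge0.
have h2 : nrm (Y n.+1 (Y n x) - Y n (Y n x)) <= (t n.+1 - t n) * (t n * nrm x).
  rewrite (le_trans (ih _))// ler_wpM2l ?sqrt_iter_nrm//.
  by rewrite subr_ge0 sqrt_iter_boundS.
have := nrmD (Y n.+1 (Y n.+1 x - Y n x)) (Y n.+1 (Y n x) - Y n (Y n x)).
rewrite (tS n.+1); move: (tS n) h1 h2; move: (t n.+1) (t n) => a b aE h1 h2 h3.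
have -> : 2^-1 * (1 + a ^+ 2) - a = 2^-1 * (a ^+ 2 - b ^+ 2) by rewrite {2}aE; lra.
by lra.
Qed.

Lemma sqrt_iter_dist m n x : (m <= n)%N ->
  nrm (Y n x - Y m x) <= (t n - t m) * nrm x.
Proof.
move=> /subnKC <-; elim: (n - m)%N => [|k ih].
  by rewrite addn0 !subrr nrm0 mul0r.
rewrite addnS -(subrKA (Y (m + k) x)) -[t _ - _](subrKA (t (m + k))) mulrDl.
by rewrite (le_trans (nrmD _ _))// lerD// sqrt_iter_step.
Qed.

Lemma sqrt_iter_bound_has_sup : has_sup (range t).
Proof.
split; first by exists (t 0), 0.
by exists 1 => _ [n _ <-]; case/andP: (sqrt_iter_bound01 n).
Qed.

Local Notation tau := (sup (range t)).

Lemma sqrt_iter_bound_le_sup n : t n <= tau.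
Proof. by apply: ub_le_sup; [case: sqrt_iter_bound_has_sup|exists n]. Qed.

Lemma sqrt_iter_bound_cvg e : 0 < e ->
  exists N, forall n, (N <= n)%N -> tau - t n < e.
Proof.
move=> e0; have [_ [N _ <-] h] := sup_adherent e0 sqrt_iter_bound_has_sup.
exists N => n Nn; suff : t N <= t n by lra.
exact: (homo_leq (@lexx _ R) (@le_trans _ R) sqrt_iter_boundS).
Qed.

Lemma sqrt_iter_lim : exists L : H -> H, forall n x,
  nrm (L x - Y n x) <= (tau - t n) * nrm x.
Proof.
have /choice[L hL] (x : H) : exists l, forall e, 0 < e ->
    exists N, forall n, (N <= n)%N -> nrm (l - Y n x) < e.
  apply: complete_seq => e e0.
  have e1 : 0 < e / (nrm x + 1) by rewrite divr_gt0// ltr_wpDl ?nrm_ge0.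
  have [N hN] := sqrt_iter_bound_cvg e1.
  exists N; suff key m n : (N <= m)%N -> (m <= n)%N -> nrm (Y n x - Y m x) < e.
    by move=> m n Nm Nn; case: (leqP m n) => [|/ltnW] mn;
      [rewrite nrm_distC|]; apply: key.
  move=> Nm mn; rewrite (le_lt_trans (sqrt_iter_dist _ mn))//.
  have := hN _ Nm; rewrite ltr_pdivlMr ?ltr_wpDl ?nrm_ge0// => h.
  have := sqrt_iter_bound_le_sup n; have := sqrt_iter_bound_le_sup m.
  by have := nrm_ge0 x; nra.
exists L => n x; rewrite -subr_le0; apply: (@le0_eps _ 1) => e e0.
have [N hN] := hL x e e0; have := hN _ (leq_maxl N n).
have := sqrt_iter_dist x (leq_maxr N n).
have := nrmD (L x - Y (maxn N n) x) (Y (maxn N n) x - Y n x).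
rewrite subrKA; have := sqrt_iter_bound_le_sup (maxn N n); have := nrm_ge0 x.
by nra.
Qed.

(* [Y] solves [2 Y = B + Y^2], that is, [(1 - Y)^2 = 1 - B]. *)
Lemma half_quadratic_eq : exists Y : {bounded H -> H},
  [/\ symmetric_op Y, forall x, nrm (Y x) <= nrm x &
      forall x, Y x + Y x = B x + Y (Y x)].
Proof.
have [L hL] := sqrt_iter_lim.
have small (K : R) (x y : H) : (forall n, nrm (x - y) <= K * (tau - t n)) -> x = y.
  move=> h; apply: (@eq_eps _ _ `|K|) => e e0.
  have [N hN] := sqrt_iter_bound_cvg e0; apply: le_trans (h N) _.
  rewrite (le_trans (ler_norm _))// normrM ler_wpM2l//.
  rewrite ger0_norm ?subr_ge0 ?sqrt_iter_bound_le_sup//.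
  by rewrite ltW// hN.
have LB n x : nrm (Y n x - L x) <= (tau - t n) * nrm x by rewrite nrm_distC.
have Ll : linear L.
  move=> a x y.
  apply: (@small (nrm (a *: x + y) + (complex.Re `|a| * nrm x + nrm y))) => n.
  rewrite -(subrKA (Y n (a *: x + y))) {2}sqrt_iter_linear mulrDl.
  rewrite (le_trans (nrmD _ _))// lerD//; first by rewrite mulrC.
  rewrite opprD addrACA -scalerBr (le_trans (nrmD _ _))// mulrDl.
  rewrite lerD//; last by rewrite mulrC.
  rewrite nrm_scale -mulrA; apply: ler_wpM2l; last by rewrite mulrC.
  by have := normr_ge0 a; rewrite lecE => /andP[].
have Ln x : nrm (L x) <= 1 * nrm x.
  rewrite mul1r -subr_le0; apply: (@le0_eps _ (nrm x)) => e e0.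
  have [N hN] := sqrt_iter_bound_cvg e0; have := hN N (leqnn _).
  have := nrmD (L x - Y N x) (Y N x); rewrite subrK.
  have := hL N x; have := sqrt_iter_nrm N x; have := nrm_ge0 x.
  by case/andP: (sqrt_iter_bound01 N) => _; nra.
have [S hS] := mk_bounded Ll Ln; exists S; split.
- suff key x y : rdot (L x) y <= rdot x (L y).
    move=> x y; rewrite !hS; apply/eqP; rewrite eq_le key.
    by rewrite (rdotC x) (rdotC _ y) key.
  rewrite -subr_le0; apply: (@le0_eps _ (2 * nrm x * nrm y)) => e e0.
  have [N hN] := sqrt_iter_bound_cvg e0; have eN := hN N (leqnn _).
  have := sqrt_iter_sym N x y.
  have := rdot_CS (L x - Y N x) y; have := rdot_CS x (Y N y - L y).
  rewrite rdotBl rdotBr => h1 h2 h3.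
  have h4 : nrm (L x - Y N x) * nrm y <= e * nrm x * nrm y.
    rewrite ler_wpM2r ?nrm_ge0// (le_trans (hL _ _))// ler_wpM2r ?nrm_ge0//.
    exact: ltW.
  have h5 : nrm x * nrm (Y N y - L y) <= nrm x * (e * nrm y).
    rewrite ler_wpM2l ?nrm_ge0// (le_trans (LB _ _))// ler_wpM2r ?nrm_ge0//.
    exact: ltW.
  by lra.
- by move=> x; rewrite hS -[leRHS]mul1r.
move=> x; rewrite !hS.
(* One summand for each of the four errors into which the defect of the equation is split below. *)
pose K := nrm x + nrm x + nrm x + nrm (L x).
apply: (@small K) => n.
have tn := sqrt_iter_bound_le_sup n; have tS := sqrt_iter_boundS n.
have h1 := hL n.+1 x.
have h2 : nrm (Y n (Y n x) - Y n (L x)) <= (tau - t n) * nrm x.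
  rewrite -sqrt_iterB (le_trans (sqrt_iter_nrm _ _))//.
  have := LB n x; have := nrm_ge0 (Y n x - L x).
  by case/andP: (sqrt_iter_bound01 n); nra.
have h3 := LB n (L x).
have -> : L x + L x - (B x + L (L x)) = (L x - Y n.+1 x) + (L x - Y n.+1 x) +
    ((Y n (Y n x) - Y n (L x)) + (Y n (L x) - L (L x))).
  rewrite subrKA.
  have -> : Y n (Y n x) = (Y n.+1 x + Y n.+1 x) - B x.
    rewrite /= -scalerDl -rmorphD/= (_ : 2^-1 + 2^-1 = 1) ?scale1r; last by lra.
    by rewrite addrC addKr.
  by rewrite -(addrA _ (- B x)) -opprD (addrACA (L x)) -(opprD (Y n.+1 x)) subrKA.
rewrite (le_trans (nrmD _ _))// (le_trans (lerD (nrmD _ _) (nrmD _ _)))//.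
have := nrm_ge0 x; rewrite /K; nra.
Qed.

End square_root.

(** * Existence of the operators defined by choice *)

Section operators_spec.
Variable R : realType.
Implicit Types H K : hilbertType R.

(** When [|T x|^2 <= M <T x, x>], the operator [B = 1 - T / M] is a contraction. The solution [Y] of
    [(1 - Y)^2 = 1 - B = T / M] yields the positive root [sqrt M (1 - Y)]. *)
Lemma op_sqrtP H (T : {bounded H -> H}) : positive_op T ->
  positive_op (op_sqrt T) /\ forall x, op_sqrt T (op_sqrt T x) = T x.
Proof.
move=> pT; rewrite /op_sqrt; case: xgetP => [S _ [pS SS]|]; first by split.
suff [S hS] : exists S : {bounded H -> H}, positive_op S /\ S \o S =1 T.
  by move=> /(_ S).
have [M M0 hM] := bounded_positive_bound pT; have sT := positive_op_sym pT.
pose B : {bounded H -> H} := idfun \- (M^-1)%:C \*: T.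
have symB : symmetric_op B.
  by move=> x y; rewrite /B /= !rdotE sT.
have [|Y [sY Y1 YE]] := half_quadratic_eq symB.
  move=> x; rewrite -(@ler_pXn2r _ 2)// ?nnegrE ?nrm_ge0// /B /= nrmB2 nrmZ rdotZr.
  rewrite exprMn real_normK ?num_real// (rdotC x).
  have := hM x; rewrite mulrC -ler_pdivrMr// => h.
  have i0 : 0 < M^-1 by rewrite invr_gt0.
  by have := positive_op_ge0 x pT; nra.
exists ((Num.sqrt M)%:C \*: (idfun \- Y)); split.
  apply: sym_ge0_positive => [x y|x] /=; first by rewrite !rdotE sY.
  rewrite rdotZl mulr_ge0 ?sqrtr_ge0// rdotBl rdotxx subr_ge0 expr2.
  by rewrite (le_trans (rdot_CS _ _))// ler_wpM2r ?nrm_ge0.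
move=> x /=; rewrite bopZ bopB -!scalerBr scalerA -rmorphM/= -expr2 sqr_sqrtr ?ltW//.
have -> : x - Y x - (Y x - Y (Y x)) = (M^-1)%:C *: T x.
  have -> : Y (Y x) = Y x + Y x - B x by rewrite YE addrC addKr.
  have e (u v : H) : u - (u + v) = - v by rewrite opprD addrA subrr add0r.
  by rewrite -(addrA (Y x)) e opprK subrKA /B /= opprB addrC subrK.
by rewrite scalerA -rmorphM/= divff ?gt_eqF// scale1r.
Qed.

Lemma closed_subspaceP H (M : closed_subspace H) a (x y : H) :
  (M : set H) x -> (M : set H) y -> (M : set H) (a *: x + y).
Proof. by case: (cs_submod M) => _ /(_ a x y); rewrite !inE. Qed.

Lemma closed_subspace0 H (M : closed_subspace H) : (M : set H) 0.
Proof. by case: (cs_submod M); rewrite inE. Qed.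

Lemma closure_nrm H (A : set H) z :
  (forall e, 0 < e -> exists2 y, A y & nrm (z - y) < e) -> closure A z.
Proof.
move=> h B /nbhs_ballP[e /= e0 zeB].
have eE : e = (complex.Re e)%:C by rewrite RRe_real// gtr0_real.
have [|y Ay zy] := h (complex.Re e); first by rewrite -ltcR -eE.
by exists y; split=> //; apply: zeB; rewrite -ball_normE /= norm_nrm eE ltcR.
Qed.

Lemma closure_nrmP H (A : set H) z : closure A z ->
  forall e, 0 < e -> exists2 y, A y & nrm (z - y) < e.
Proof.
move=> cz e e0; have [|y [Ay]] := cz _ (nbhsx_ballx z e%:C _); first by rewrite ltcR.
by rewrite -ball_normE /= norm_nrm ltcR => ?; exists y.
Qed.

Lemma orth_proj_ex H (M : closed_subspace H) : exists P : {bounded H -> H},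
  (forall x : H, (M : set H) (P x)) /\
  (forall x y : H, (M : set H) y -> rdot (x - P x) y = 0).
Proof.
have /choice[P hP] (x : H) : exists z : H, (M : set H) z /\
    (forall y : H, (M : set H) y -> rdot (x - z) y = 0).
  have [||||z cz oz] := @riesz_subspace R H M (rdot x) (nrm x).
  - exact: closed_subspace0.
  - by move=> a u v; exact: closed_subspaceP.
  - by move=> a u v; rewrite rdotDr rdotZr.
  - by move=> u; exact: rdot_CS.
  exists z; split; first exact/cs_closed/closure_nrm.
  by move=> y My; rewrite rdotBl oz// subrr.
have Pu x z : (M : set H) z ->
    (forall y : H, (M : set H) y -> rdot (x - z) y = 0) -> P x = z.
  move=> Mz oz; apply/subr0_eq/nrm_eq0/eqP; rewrite -sqrf_eq0 -rdotxx.
  have Md : (M : set H) (P x - z).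
    by rewrite addrC -scaleN1r; apply: closed_subspaceP => //; case: (hP x).
  have e : P x - z = (x - z) - (x - P x) by rewrite opprB [RHS]addrC addrA subrK.
  by rewrite {1}e rdotBl (oz _ Md) ((hP x).2 _ Md) subrr.
have Pl : linear P.
  move=> a x y; apply: Pu.
    by apply: closed_subspaceP; [case: (hP x)|case: (hP y)].
  move=> z Mz; rewrite opprD addrACA -scalerBr rdotDl (hP y).2// addr0.
  have := (hP x).2 z Mz; have := (hP x).2 ('i%C *: z).
  rewrite -(addr0 ('i%C *: z)) => /(_ (closed_subspaceP _ Mz (closed_subspace0 M))).
  rewrite addr0 => h1 h2; have i1 : inner (x - P x) z = 0 by rewrite inner_rdotE h1 h2.
  by rewrite /rdot linearZl_LR /= i1 mulr0.
have Pn x : nrm (P x) <= 1 * nrm x.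
  rewrite mul1r -(@ler_pXn2r _ 2)// ?nnegrE ?nrm_ge0//.
  have := (hP x).2 (P x) (hP x).1; rewrite rdotBl rdotxx => h.
  by have := sqr_ge0 (nrm (x - P x)); rewrite nrmB2; lra.
have [S hS] := mk_bounded Pl Pn; exists S.
by split => [x|x y]; rewrite hS; case: (hP x) => // _; apply.
Qed.

Lemma adjoint_rdotl H K (T : {bounded H -> K}) x y :
  rdot (adjoint T x) y = rdot x (T y).
Proof. by rewrite rdotC -adjoint_rdot rdotC. Qed.

Lemma op_absP H K (T : {bounded H -> K}) :
  positive_op (op_abs T) /\ forall x, op_abs T (op_abs T x) = adjoint T (T x).
Proof.
apply: op_sqrtP; apply: sym_ge0_positive => [x y|x] /=.
  by rewrite adjoint_rdotl adjoint_rdot.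
by rewrite adjoint_rdotl rdotxx sqr_ge0.
Qed.

Lemma op_invP H (T : {bounded H -> H}) (c : R) : 0 < c ->
  (forall x, c * nrm x ^+ 2 <= rdot (T x) x) ->
  (forall x, op_inv T (T x) = x) /\ (forall x, T (op_inv T x) = x).
Proof.
move=> c0 cT; rewrite /op_inv; case: xgetP => [S _ [ST TS]|]; first by split.
by have [S hS] := coercive_inv c0 cT => /(_ S).
Qed.

End operators_spec.

(** * The matched projection *)

Section matched_projection_theory.
Variables (R : realType) (H : hilbertType R) (Q : {bounded H -> H}).
Hypothesis idemQ : op_idempotent Q.

Local Notation A := (adjoint Q).
Local Notation W := (op_abs (adjoint Q)).
Local Notation X := (moore_penrose W).
Local Notation I := (op_inv (W \+ idfun)).
Local Notation m := (matched_proj Q).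

Let Q_rdot x y : rdot (Q x) y = rdot x (A y). Proof. exact: adjoint_rdot. Qed.

Let QQ x : Q (Q x) = Q x. Proof. exact: idemQ. Qed.

Let AA x : A (A x) = A x.
Proof. by apply: rdot_inj => z; rewrite !adjoint_rdotl QQ. Qed.

Let posW : positive_op W. Proof. by case: (op_absP A). Qed.
Let symW : symmetric_op W. Proof. exact: positive_op_sym. Qed.
Let WW x : W (W x) = Q (A x).
Proof. by case: (op_absP A) => _ ->; rewrite adjointK. Qed.

(** [|W (x - A x)|^2 = <Q A (x - A x), x - A x>], which vanishes since [A] is idempotent. Taking
    adjoints gives [Q W = W]. *)
Let WA x : W (A x) = W x.
Proof.
apply/esym/subr0_eq/nrm_eq0/eqP; rewrite -sqrf_eq0 -rdotxx -bopB -symW WW.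
by rewrite bopB AA subrr bop0 rdot0l.
Qed.

Let QW x : Q (W x) = W x.
Proof. by apply: rdot_inj => z; rewrite Q_rdot symW WA -symW. Qed.

(** An invertible substitute for [W^2]: it satisfies [K W = W^3 = W K]. Its inverse [J] commutes
    with [W], and [W J] is a Moore-Penrose inverse of [W]. *)
Let K : {bounded H -> H} := (Q \o A) \+ ((idfun \- A) \o (idfun \- Q)).

Let symK : symmetric_op K.
Proof.
move=> x y; rewrite /K /= !(bopB, rdotBl, rdotBr, rdotDl, rdotDr).
by rewrite !Q_rdot !adjoint_rdotl !Q_rdot; ring.
Qed.

(** The form of [K] is [|A x|^2 + |x - Q x|^2], while [|x|^2 = <x, A x> + <x - Q x, x>] gives
    [|x| <= |A x| + |x - Q x|]. The constant comes from [(a + b)^2 <= 2 (a^2 + b^2)]. *)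
Let K_coercive x : 2^-1 * nrm x ^+ 2 <= rdot (K x) x.
Proof.
have -> : rdot (K x) x = nrm (A x) ^+ 2 + nrm (x - Q x) ^+ 2.
  rewrite /K /= rdotDl rdotBl Q_rdot (adjoint_rdotl Q (x - Q x)) rdotxx.
  by rewrite -rdotBr rdotxx.
have h1 : nrm x ^+ 2 = rdot x (A x) + rdot (x - Q x) x.
  by rewrite -Q_rdot -rdotDl addrC subrK rdotxx.
have h2 := rdot_CS x (A x); have h3 := rdot_CS (x - Q x) x.
have {h1 h2 h3} h : nrm x ^+ 2 <= nrm x * (nrm (A x) + nrm (x - Q x)) by lra.
move: h (nrm_ge0 x) (nrm_ge0 (A x)) (nrm_ge0 (x - Q x)).
move: (nrm x) (nrm (A x)) (nrm (x - Q x)) => n a b h n0 a0 b0.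
have [nE|nn] := eqVneq n 0; first by rewrite nE expr0n mulr0; nra.
have npos : 0 < n by rewrite lt0r nn.
have : n <= a + b by rewrite -(ler_pM2l npos) -expr2.
by have := sqr_ge0 (a - b); nra.
Qed.

Let KW x : K (W x) = W (W (W x)).
Proof. by rewrite /K /= QW subrr bop0 subr0 addr0 WW. Qed.

Let WK x : W (K x) = W (W (W x)).
Proof. by rewrite /K /= bopD bopB WA subrr addr0 -WW. Qed.

Let moore_penrose_ex : exists X : {bounded H -> H},
  [/\ W \o X \o W =1 W, X \o W \o X =1 X,
      adjoint (W \o X) =1 W \o X & adjoint (X \o W) =1 X \o W].
Proof.
have [|J [JK' KJ']] := coercive_inv (T := K) _ K_coercive; first by rewrite invr_gt0.
have JK x : J (K x) = x by exact: JK'.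
have KJ x : K (J x) = x by exact: KJ'.
have WJ x : W (J x) = J (W x) by rewrite -[LHS]JK KW -WK KJ.
have symJ : symmetric_op J by move=> x y; rewrite -{1}(KJ y) -symK KJ.
exists (W \o J); split.
- by move=> x /=; rewrite !WJ -KW JK.
- by move=> x /=; rewrite [LHS]WJ -KW JK.
- by apply: adjoint_uniq => x y /=; rewrite !symW symJ !WJ.
- by apply: adjoint_uniq => x y /=; rewrite !symW symJ symW !WJ.
Qed.

Let mpP : [/\ W \o X \o W =1 W, X \o W \o X =1 X,
  adjoint (W \o X) =1 W \o X & adjoint (X \o W) =1 X \o W].
Proof.
rewrite /moore_penrose; case: xgetP => [//|].
by have [Y hY] := moore_penrose_ex => /(_ Y).
Qed.

Let WXW x : W (X (W x)) = W x. Proof. by case: mpP => + _ _ _; exact. Qed.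
Let XWX x : X (W (X x)) = X x. Proof. by case: mpP => _ + _ _; exact. Qed.
Let symWX x y : rdot (W (X x)) y = rdot x (W (X y)).
Proof. by case: mpP => _ _ + _; rewrite -[W (X x)]/((W \o X) x) adjoint_rdot => ->. Qed.
Let symXW x y : rdot (X (W x)) y = rdot x (X (W y)).
Proof. by case: mpP => _ _ _ +; rewrite -[X (W x)]/((X \o W) x) adjoint_rdot => ->. Qed.

Let WWX x : W (W (X x)) = W x.
Proof. by apply: rdot_inj => z; rewrite symW symWX WXW symW. Qed.

Let XWW x : X (W (W x)) = W x.
Proof. by apply: rdot_inj => z; rewrite symXW symW WXW symW. Qed.

Let XW x : X (W x) = W (X x).
Proof. by rewrite -{1}WWX XWW. Qed.

Let symX : symmetric_op X.
Proof.
have XE u : X u = W (X (X u)) by rewrite -XW XWX.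
by move=> x y; rewrite (XE x) symWX -symW symWX -XE.
Qed.

Let AWX x : A (W (X x)) = A x.
Proof.
apply/esym/subr0_eq/nrm_eq0/eqP; rewrite -sqrf_eq0 -rdotxx -bopB.
by rewrite -Q_rdot -WW !bopB WWX subrr rdot0l.
Qed.

Let WXQ x : W (X (Q x)) = Q x.
Proof. by apply: rdot_inj => z; rewrite symWX Q_rdot AWX -Q_rdot. Qed.

Let invP : (forall x, I (W x + x) = x) /\ (forall x, W (I x) + I x = x).
Proof.
apply: (op_invP (T := W \+ idfun) (c := 1)) => // x /=.
by rewrite mul1r rdotDl rdotxx lerDr positive_op_ge0.
Qed.

Let IW1 x : I (W x + x) = x. Proof. by case: invP. Qed.
Let W1I x : W (I x) + I x = x. Proof. by case: invP. Qed.

Let IX x : I (X x) = X (I x).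
Proof. by rewrite -{1}[x]W1I bopD XW IW1. Qed.

Let IW x : I (W x) = W (I x).
Proof. by rewrite -{1}[x]W1I bopD IW1. Qed.

Let symI : symmetric_op I.
Proof. by move=> x y; rewrite -{1}(W1I y) rdotDr -symW -rdotDl W1I. Qed.

(** The right-hand factors of the formula for [m], so that [2 m = (W + A) v]. *)
Let v x := X (I (W x + Q x)).

Let mE x : m x = 2^-1%:C *: (W (v x) + A (v x)).
Proof.
by rewrite fmorphV rmorph_nat.
Qed.

Let Wv x : W (v x) = I (W x + Q x).
Proof. by rewrite /v -IX -IW bopD bopD WXW WXQ. Qed.

Lemma idempotent_matched x : Q (m x) = 2^-1%:C *: (W x + Q x).
Proof. by rewrite mE bopZ bopD QW -WW Wv addrC W1I. Qed.

Lemma matched_abs x : m (W x) = 2^-1%:C *: (W x + A x).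
Proof. by rewrite mE /v QW IW1 WXW XW AWX. Qed.

Let matched_adj x : m (A x) = 2^-1%:C *: (W x + A x).
Proof. by rewrite mE /v WA -WW (addrC (W x)) IW1 WXW XW AWX. Qed.

(** The adjoint of [W + A] is [W + Q], so [2 <m x, y> = <X I (W + Q) x, (W + Q) y>]; [X] and [I] are
    symmetric and commute. *)
Lemma matched_sym : symmetric_op m.
Proof.
have E x y : rdot (W (v x) + A (v x)) y = rdot (X (I (W x + Q x))) (W y + Q y).
  by rewrite rdotDl symW adjoint_rdotl -rdotDr.
move=> x y; rewrite !mE rdotZl rdotZr (rdotC x) !E rdotC.
by rewrite symX symI IX.
Qed.

Let half : 2^-1%:C + 2^-1%:C = 1 :> R[i].
Proof. by rewrite -rmorphD/= (_ : 2^-1 + 2^-1 = 1) //; lra. Qed.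

(** [m] sends both [W] and [A] to [(W + A) / 2], hence fixes [(W + A) / 2], the left factor of its
    own formula. *)
Lemma matched_idem x : m (m x) = m x.
Proof.
by rewrite [m x in LHS]mE bopZ bopD matched_abs matched_adj -scalerDl half scale1r -mE.
Qed.

Let half_inj (u : H) : 2^-1%:C *: u = 0 -> u = 0.
Proof.
by move=> /eqP; rewrite scaler_eq0 fmorph_eq0 invr_eq0 pnatr_eq0 /= => /eqP.
Qed.

(** From [2 Q m = W + Q]: here [W x = 0] as well, and the formula for [m] then kills [x = m x]. *)
Lemma matched_ker x : m x = x -> Q x = 0 -> x = 0.
Proof.
move=> mx Qx; have := idempotent_matched x; rewrite mx Qx addr0 => /esym/half_inj Wx.
by rewrite -mx mE /v Wx Qx addr0 !bop0 addr0 scaler0.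
Qed.

(** The same identity now reads [W x + x = 0], impossible for a positive [W] unless [x = 0]. *)
Lemma matched_ran x : m x = 0 -> Q x = x -> x = 0.
Proof.
move=> mx Qx; have := idempotent_matched x; rewrite mx bop0 Qx => /esym/half_inj h.
by apply: (positive_op_addc_inj (c := 1) posW) => //; rewrite scale1r.
Qed.

Lemma op_abs_matched x : W x = Q (m x) + Q (m x) - Q x.
Proof.
by rewrite idempotent_matched -scalerDl half scale1r addrK.
Qed.

(* [Q^* = (2 m - 1) Q (2 m - 1)]. *)
Lemma adjoint_matched x : A x = m (W x) + m (W x) - W x.
Proof.
by rewrite matched_abs -scalerDl half scale1r addrC addKr.
Qed.

End matched_projection_theory.

(* Otherwise [/=] unfolds the formula defining the matched projection. *)
Opaque matched_proj.

(** * The summands of the canonical decomposition *)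

Section canonical_decomposition_theory.
Variables (R : realType) (H : hilbertType R) (Q : {bounded H -> H}).
Hypothesis idemQ : op_idempotent Q.

Local Notation A := (adjoint Q).
Local Notation m := (matched_proj Q).

Let QQ x : Q (Q x) = Q x. Proof. exact: idemQ. Qed.

Let symm := matched_sym idemQ.
Let mm := matched_idem idemQ.

(** [W] and [Q] agree on the range of [m], and [A = (2 m - 1) W]; so the corner of [A] leaving this
    range is the opposite of that of [Q]. This turns orthogonality to [H5], a condition on [A], into
    one on [Q]. *)
Let adj_ran x : m x = x -> A x - m (A x) = m (Q x) - Q x.
Proof.
move=> mx; have WQ : op_abs A x = Q x by rewrite op_abs_matched// mx addrK.
by rewrite adjoint_matched// WQ bopB bopD !mm addrK addrAC addrK.
Qed.

Let adj_ker x : m x = 0 -> m (A x) = - m (Q x).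
Proof.
move=> mx; have WQ : op_abs A x = - Q x by rewrite op_abs_matched// mx bop0 !add0r.
by rewrite adjoint_matched// WQ bopB bopD !mm addrK bopN.
Qed.

Lemma rdot_closed_range (T : {bounded H -> H}) (x y : H) :
  (forall u, rdot x (T u) = 0) -> (closed_range T : set H) y -> rdot x y = 0.
Proof.
move=> xT /closure_nrmP hy.
suff key z : (forall u, rdot z (T u) = 0) -> rdot z y <= 0.
  apply/eqP; rewrite eq_le key// -oppr_le0 -rdotNl key// => u.
  by rewrite rdotNl xT oppr0.
move=> zT; apply: (@le0_eps _ (nrm z)) => e e0.
have [_ [u _ <-] yu] := hy _ e0; rewrite -(subrK (T u) y) rdotDr zT addr0.
by rewrite (le_trans (rdot_CS _ _))// ler_wpM2l ?nrm_ge0// ltW.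
Qed.

Lemma closed_range_eq (T S : {bounded H -> H}) (y : H) :
  (forall u, S (T u) = 0) -> (closed_range T : set H) y -> S y = 0.
Proof.
move=> ST hy; apply: rdot_eq0 => z; rewrite adjoint_rdot rdotC.
apply: rdot_closed_range hy => u.
by rewrite adjoint_rdotl ST rdot0r.
Qed.

Lemma H5_matched (y : H) : (H5 Q : set H) y -> m y = y.
Proof.
move=> /(@closed_range_eq _ (idfun \- m)) h; apply/esym/subr0_eq/h => u /=.
by rewrite mm subrr.
Qed.

Lemma H6_matched (y : H) : (H6 Q : set H) y -> m y = 0.
Proof. by move=> /(@closed_range_eq _ m); apply => u /=; rewrite bopB mm subrr. Qed.

Lemma H1P x : H1 Q x <-> m x = x /\ Q x = x.
Proof.
split=> [[[y _ <-] [z _ mQ]]|[mx Qx]]; last by split; exists x.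
by split; [exact: mm|rewrite -mQ; exact: idemQ].
Qed.

Lemma H4P x : H4 Q x <-> m x = 0 /\ Q x = 0. Proof. by []. Qed.

Let dot5 x u : m x = x -> rdot x (m (Q (u - m u))) = rdot (m (Q x) - Q x) u.
Proof. by move=> mx; rewrite -symm mx -adjoint_rdotl rdotBr -symm -rdotBl adj_ran. Qed.

Let dot6 x u : m x = 0 ->
  rdot x (Q (m u) - m (Q (m u))) = - rdot (m (Q x)) u.
Proof.
by move=> mx; rewrite rdotBr -(symm x) mx rdot0l subr0 -adjoint_rdotl -symm adj_ker// rdotNl.
Qed.

Lemma H1_orth_H5 x y : H1 Q x -> (H5 Q : set H) y -> rdot x y = 0.
Proof.
move=> /H1P[mx Qx]; apply: rdot_closed_range => u /=.
by rewrite dot5// Qx mx subrr rdot0l.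
Qed.

Lemma H4_orth_H6 x y : H4 Q x -> (H6 Q : set H) y -> rdot x y = 0.
Proof.
move=> /H4P[mx Qx]; apply: rdot_closed_range => u /=.
by rewrite dot6// Qx bop0 rdot0l oppr0.
Qed.

(** Orthogonality to [H5] says [m (Q x) = Q x]. Then [x - Q x] lies in the range of [m] and in the
    kernel of [Q], so it is zero by [matched_ker]. *)
Lemma orth_H5 (x : H) : m x = x ->
  (forall y : H, (H5 Q : set H) y -> rdot x y = 0) -> H1 Q x.
Proof.
move=> mx ox; apply/H1P; split => //; apply/esym/subr0_eq.
have mQx : m (Q x) = Q x.
  apply/subr0_eq/rdot_eq0 => u; rewrite -dot5// ox//.
  by apply: subset_closure; exists u.
apply: (matched_ker idemQ); first by rewrite bopB mx mQx.
by rewrite bopB QQ subrr.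
Qed.

(** Orthogonality to [H6] says [m (Q x) = 0], so [Q x] lies in the kernel of [m] and in the range of
    [Q]; [matched_ran] applies. *)
Lemma orth_H6 (x : H) : m x = 0 ->
  (forall y : H, (H6 Q : set H) y -> rdot x y = 0) -> H4 Q x.
Proof.
move=> mx ox; split => //; apply: (matched_ran idemQ); last exact: idemQ.
apply: rdot_eq0 => u; rewrite -[LHS]opprK -dot6// ox ?oppr0//.
by apply: subset_closure; exists u.
Qed.

Let P5 := xget (\0 : {bounded H -> H}) [set P : {bounded H -> H} |
  (forall x : H, (H5 Q : set H) (P x)) /\
  (forall x y : H, (H5 Q : set H) y -> rdot (x - P x) y = 0)].
Let P6 := xget (\0 : {bounded H -> H}) [set P : {bounded H -> H} |
  (forall x : H, (H6 Q : set H) (P x)) /\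
  (forall x y : H, (H6 Q : set H) y -> rdot (x - P x) y = 0)].

Let P5P : (forall x : H, (H5 Q : set H) (P5 x)) /\
  (forall x y : H, (H5 Q : set H) y -> rdot (x - P5 x) y = 0).
Proof. by rewrite /P5; case: xgetP => // h; have [P /(h P)] := orth_proj_ex (H5 Q). Qed.

Let P6P : (forall x : H, (H6 Q : set H) (P6 x)) /\
  (forall x y : H, (H6 Q : set H) y -> rdot (x - P6 x) y = 0).
Proof. by rewrite /P6; case: xgetP => // h; have [P /(h P)] := orth_proj_ex (H6 Q). Qed.

Let csZ (M : closed_subspace H) (y : H) : (M : set H) y -> (M : set H) ('i%C *: y).
Proof.
by move=> My; rewrite -[_ *: y]addr0; apply: closed_subspaceP => //; exact: closed_subspace0.
Qed.

Let orth_proj5 : orth_proj (H5 Q) =1 P5.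
Proof. by apply: orth_projP; [exact: P5P.1|exact: P5P.2|exact: csZ]. Qed.

Let orth_proj6 : orth_proj (H6 Q) =1 P6.
Proof. by apply: orth_projP; [exact: P6P.1|exact: P6P.2|exact: csZ]. Qed.

Let orth_proj1 : orth_proj (H1 Q) =1 m \- P5.
Proof.
apply: (@orth_projP _ _ _ (m \- P5 : {bounded H -> H})) => [x|x y Hy|y /H1P[my Qy]] /=.
- apply: orth_H5 => [|y Hy]; first by rewrite bopB mm (H5_matched (P5P.1 x)).
  by rewrite rdotBl symm H5_matched// -rdotBl P5P.2.
- have [my _] := (H1P y).1 Hy; rewrite opprB addrA rdotBl rdotDl (rdotC (P5 x)).
  by rewrite (H1_orth_H5 Hy (P5P.1 x)) addr0 symm my subrr.
- by apply/H1P; rewrite !bopZ my Qy.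
Qed.

Let orth_proj4 : orth_proj (H4 Q) =1 (idfun \- m) \- P6.
Proof.
apply: (@orth_projP _ _ _ ((idfun \- m) \- P6 : {bounded H -> H})) => [x|x y Hy|y /H4P[my Qy]] /=.
- apply: orth_H6 => [|y Hy]; first by rewrite !bopB mm (H6_matched (P6P.1 x)) subrr subr0.
  by rewrite addrAC rdotBl symm H6_matched// rdot0r subr0 P6P.2.
- have [my _] := (H4P y).1 Hy; rewrite !opprB addrCA (addrC x) subrK.
  by rewrite rdotDl symm my rdot0r addr0 rdotC (H4_orth_H6 Hy (P6P.1 x)).
- by apply/H4P; rewrite !bopZ my Qy !scaler0.
Qed.

Lemma corestrictK (M : closed_subspace H) (x : H) : (M : set H) x ->
  cs_val (corestrict M x) = x.
Proof. by move=> Mx; rewrite [LHS]insubdK// inE. Qed.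

Lemma canonical_mapK x : canonical_map_adj (canonical_map Q x) = x.
Proof.
rewrite /canonical_map /canonical_map_adj orth_proj1 orth_proj4 /=.
rewrite !corestrictK ?orth_proj5 ?orth_proj6; [|exact: P6P.1|exact: P5P.1].
by rewrite [_ + P5 x]addrAC subrK -addrA subrK addrC subrK.
Qed.

Lemma canonical_map_mem x :
  H1 Q (canonical_map Q x).1.1.1 /\ H4 Q (canonical_map Q x).1.1.2.
Proof.
rewrite /canonical_map /= orth_proj1 orth_proj4 /=.
split; first last.
  apply: orth_H6 => [|y Hy]; first by rewrite !bopB mm (H6_matched (P6P.1 x)) subrr subr0.
  by rewrite addrAC rdotBl symm H6_matched// rdot0r subr0 P6P.2.
apply: orth_H5 => [|y Hy]; first by rewrite bopB mm (H5_matched (P5P.1 x)).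
by rewrite rdotBl symm H5_matched// -rdotBl P5P.2.
Qed.

Lemma cs_valP' (M : closed_subspace H) (x : cs_type M) : (M : set H) (cs_val x).
Proof. by have := cs_valP x; rewrite inE. Qed.

Lemma matched_canonical (v : H * H * cs_type (H5 Q) * cs_type (H6 Q)) :
  H1 Q v.1.1.1 -> H4 Q v.1.1.2 -> m (canonical_map_adj v) = v.1.1.1 + cs_val v.1.2.
Proof.
case: v => [[[x1 x4] x5] x6] /= /H1P[m1 _] /H4P[m4 _].
rewrite !bopD m1 m4 (H5_matched (cs_valP' x5)) (H6_matched (cs_valP' x6)).
by rewrite !addr0.
Qed.

End canonical_decomposition_theory.

(** * Elliptical discs *)

Section ellipse.
Variable R : realType.
Implicit Types s t q u v p : R.

(* The numerical range of [[1 + t, - sqrt q], [0, 0]] is the union over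
   [0 <= p <= 1] of the circles of centre [(1 + t) p] and squared radius
   [q p (1 - p)]; the point [u + i v] is on the circle of index [p] when the
   following polynomial vanishes. *)
Definition circle t q p u v : R := (u - (1 + t) * p) ^+ 2 + v ^+ 2 - q * (p * (1 - p)).

(** The discriminant of [circle] as a quadratic polynomial in [p], with leading coefficient
    [(1 + t)^2 + q]. The union of the circles is the set where it is nonnegative. *)
Definition ellipse_disc t q u v : R :=
  (2 * (1 + t) * u + q) ^+ 2 - 4 * ((1 + t) ^+ 2 + q) * (u ^+ 2 + v ^+ 2).

Lemma circle_disc t q p u v : ellipse_disc t q u v =
  (2 * ((1 + t) ^+ 2 + q) * p - (2 * (1 + t) * u + q)) ^+ 2
  - 4 * ((1 + t) ^+ 2 + q) * circle t q p u v.
Proof. by rewrite /ellipse_disc /circle; ring. Qed.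

Lemma circle_disc_ge0 t q p u v : 0 <= q -> circle t q p u v <= 0 ->
  0 <= ellipse_disc t q u v.
Proof.
move=> q0 f0; rewrite (circle_disc _ _ p) subr_ge0 (le_trans _ (sqr_ge0 _))//.
by rewrite mulr_ge0_le0// mulr_ge0// addr_ge0// sqr_ge0.
Qed.

(** The larger root serves as [p]. It lies in [[0, 1]] because [q p (1 - p)] equals a sum of two
    squares. *)
Lemma disc_circle t q u v : 0 < q -> 0 <= ellipse_disc t q u v ->
  exists2 p, 0 <= p <= 1 & circle t q p u v = 0.
Proof.
move=> q0 d0; pose k := (1 + t) ^+ 2 + q; pose b := 2 * (1 + t) * u + q.
have k0 : 0 < k by have := sqr_ge0 (1 + t); rewrite /k; lra.
pose p := (b + Num.sqrt (ellipse_disc t q u v)) / (2 * k).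
have fp : circle t q p u v = 0.
  have := circle_disc t q p u v; rewrite -/k -/b.
  have -> : 2 * k * p - b = Num.sqrt (ellipse_disc t q u v) by rewrite /p; field; lra.
  rewrite sqr_sqrtr// => /eqP; rewrite eq_sym subr_eq addrC -subr_eq subrr eq_sym.
  by rewrite !mulf_eq0 (gt_eqF k0) pnatr_eq0 => /eqP.
exists p => //; move: fp; rewrite /circle; move: p => p fp.
have : 0 <= p * (1 - p).
  rewrite -(pmulr_rge0 _ q0).
  by have := sqr_ge0 (u - (1 + t) * p); have := sqr_ge0 v; lra.
by move=> h; apply/andP; split; nra.
Qed.

(** A point strictly inside a disc for [s] stays inside when [s] is lowered slightly. It is applied
    with [t = <D e, e>] and [q = |ell(D) e|^2], which is at least [t (t - 1)]. *)
Lemma circle_approx s p u v : 1 < s -> 0 <= p <= 1 ->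
  circle s (s * (s - 1)) p u v < 0 ->
  exists2 t0, t0 < s & forall t q, t0 < t -> 1 < t -> t <= s ->
    t * (t - 1) <= q -> circle t q p u v <= 0.
Proof.
(* [K] bounds the increase of [circle] per unit decrease of [s], so [t0] is where the available
   slack would be used up. *)
move=> s1 /andP[p0 p1] f0; pose K := 2 * `|u| + 2 * s.
have K0 : 0 < K by rewrite /K; have := normr_ge0 u; lra.
exists (s + circle s (s * (s - 1)) p u v / K).
  by rewrite gtrDl pmulr_llt0// invr_gt0.
move=> t q; rewrite -ltrBrDl ltr_pdivrMr// => tK t1 ts tq.
have pp : 0 <= p * (1 - p) by nra.
have pp1 : p * (1 - p) <= 1 by nra.
have h1 : q * (p * (1 - p)) >= t * (t - 1) * (p * (1 - p)) by nra.
have h2 : circle t (t * (t - 1)) p u v - circle s (s * (s - 1)) p u v =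
    (s - t) * (p * (2 * u) - (2 + t + s) * p ^+ 2 + (s + t - 1) * (p * (1 - p))).
  by rewrite /circle; ring.
have h3 : p * (2 * u) <= 2 * `|u| by have := ler_norm u; have := normr_ge0 u; nra.
have h4 : (s + t - 1) * (p * (1 - p)) <= 2 * s by nra.
have h5 : p * (2 * u) - (2 + t + s) * p ^+ 2 + (s + t - 1) * (p * (1 - p)) <= K.
  have : 0 <= (2 + t + s) * p ^+ 2 by rewrite mulr_ge0 ?sqr_ge0//; lra.
  by rewrite /K; lra.
have h6 : circle t (t * (t - 1)) p u v <= 0.
  have h7 : 0 <= s - t by lra.
  by have := ler_wpM2l h7 h5; lra.
by move: h6; rewrite /circle; lra.
Qed.

(** At the origin [circle] is [k p^2 - q p] with [k = (1 + s)^2 + q]; the witness is its minimum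
    point [q / (2 k)]. *)
Lemma circle_origin s : 1 < s ->
  exists2 p, 0 <= p <= 1 & circle s (s * (s - 1)) p 0 0 < 0.
Proof.
move=> s1; have q0 : 0 < s * (s - 1) by nra.
move: (s * (s - 1)) q0 => q q0.
have k0 : 0 < (1 + s) ^+ 2 + q by have := sqr_ge0 (1 + s); lra.
have p0 : 0 < q / (2 * ((1 + s) ^+ 2 + q)) by rewrite divr_gt0// mulr_gt0.
have kp : ((1 + s) ^+ 2 + q) * (q / (2 * ((1 + s) ^+ 2 + q))) = q / 2 by field; lra.
exists (q / (2 * ((1 + s) ^+ 2 + q))).
  rewrite ltW// ler_pdivrMr ?mulr_gt0//.
  by have := sqr_ge0 (1 + s); lra.
by rewrite /circle; move: (q / _) p0 kp => p p0 kp; nra.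
Qed.

(** Here [n1 = |x1|^2], [n5 = |x5|^2] and [g = <D x5, x5>]. Choosing [p] so that [(1 + s) p] is the
    centre leaves the slack [s (n1 + n5) - (n1 + g)], which vanishes only if [n1 = 0] and
    [g = s n5]. *)
Lemma circle_cover s n1 n5 g u v : 1 < s -> 0 <= n1 -> 0 <= n5 -> n1 + n5 <= 1 ->
  n5 <= g -> g <= s * n5 ->
  (u - (n1 + n1 + n5 + g)) ^+ 2 + v ^+ 2 <= (1 - (n1 + n5)) * ((s - 1) * g) ->
  (exists2 p, 0 <= p <= 1 & circle s (s * (s - 1)) p u v < 0) \/
  [/\ 0 < n5, g = s * n5 & exists2 p, 0 <= p <= 1 & circle s (s * (s - 1)) p u v <= 0].
Proof.
move=> s1 n10 n50 n1n5 n5g gs hz.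
set p := (n1 + n1 + n5 + g) / (1 + s).
have pE : (1 + s) * p = n1 + n1 + n5 + g by rewrite /p; field; lra.
move: p pE => p pE; have p0 : 0 <= p by nra.
have p1 : p <= n1 + n5 by nra.
have sG : n1 + g <= s * (n1 + n5) by nra.
have key : (1 + s) * circle s (s * (s - 1)) p u v <=
    - ((s - 1) * ((s * (n1 + n5) - (n1 + g)) * ((1 - (n1 + n5)) + s * p))).
  rewrite /circle pE.
  have -> : (1 + s) * ((u - (n1 + n1 + n5 + g)) ^+ 2 + v ^+ 2 - s * (s - 1) * (p * (1 - p))) =
    (1 + s) * ((u - (n1 + n1 + n5 + g)) ^+ 2 + v ^+ 2)
    - s * (s - 1) * (((1 + s) * p) * (1 - p)) by ring.
  have h1 : (1 + s) * ((u - (n1 + n1 + n5 + g)) ^+ 2 + v ^+ 2) <=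
      (1 + s) * ((1 - (n1 + n5)) * ((s - 1) * g)) by rewrite ler_wpM2l//; lra.
  (* Enlarging [g] to [n1 + g] makes the remaining difference factor exactly, with the slack as a
     factor. *)
  have h2 : (1 - (n1 + n5)) * ((s - 1) * g) <= (1 - (n1 + n5)) * ((s - 1) * (n1 + g)).
    by rewrite ler_wpM2l ?subr_ge0// ler_wpM2l; lra.
  have h3 : (1 + s) * ((1 - (n1 + n5)) * ((s - 1) * (n1 + g))) -
     s * (s - 1) * (((1 + s) * p) * (1 - p)) =
     - ((s - 1) * ((s * (n1 + n5) - (n1 + g)) * ((1 - (n1 + n5)) + s * p))).
    have -> : g = (1 + s) * p - n1 - n1 - n5 by lra.
    by ring.
  by rewrite -h3; nra.
have s10 : 0 < 1 + s by lra.
have [lt|ge] := ltP (n1 + g) (s * (n1 + n5)).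
  left; exists p; first by rewrite p0 (le_trans p1).
  rewrite -(pmulr_rlt0 _ s10) (le_lt_trans key)// oppr_lt0 mulr_gt0 ?subr_gt0//.
  rewrite mulr_gt0 ?subr_gt0//.
  have [->|nE] := eqVneq (n1 + n5) 1; last first.
    by rewrite ltr_wpDr ?mulr_ge0//; [lra|rewrite subr_gt0 lt_neqAle nE].
  rewrite subrr add0r; have : 0 < p by nra.
  by nra.
have n1E : n1 = 0 by nra.
have gE : g = s * n5 by nra.
(* If [n5 = 0] too, the point is the origin, which is interior. *)
have [n5E|n5N] := eqVneq n5 0.
  left; move: hz; rewrite gE n1E n5E !mulr0 !addr0 subr0 => hz.
  have -> : u = 0 by nra.
  have -> : v = 0 by nra.
  exact: circle_origin.
right; split => //; first by rewrite lt0r n5N.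
exists p; first by rewrite p0 (le_trans p1).
rewrite -(pmulr_rle0 _ s10) (le_trans key)// oppr_le0 mulr_ge0 ?subr_ge0 ?(ltW s1)//.
rewrite mulr_ge0 ?subr_ge0//; nra.
Qed.

Lemma continuous_Re : continuous (@complex.Re R : R[i] -> R).
Proof.
move=> z; have F : Filter (nbhs z) by exact: nbhs_filter.
apply/(@cvgrPdist_lt _ R _ _ F (@complex.Re R)) => e e0.
apply/(@nbhs_ballP R[i] R[i]); exists e%:C => /=.
  by rewrite ltcR.
move=> w; rewrite -ball_normE /= => zw; rewrite -raddfB -ltcR.
exact: le_lt_trans (normc_ge_Re _) zw.
Qed.

Lemma continuous_Im : continuous (@complex.Im R : R[i] -> R).
Proof.
move=> z; have F : Filter (nbhs z) by exact: nbhs_filter.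
apply/(@cvgrPdist_lt _ R _ _ F (@complex.Im R)) => e e0.
apply/(@nbhs_ballP R[i] R[i]); exists e%:C => /=.
  by rewrite ltcR.
move=> w; rewrite -ball_normE /= => zw; rewrite -ltcR.
have -> : complex.Im z - complex.Im w = - complex.Re ((z - w) * 'i%C).
  by rewrite ReiNIm opprK; case: (z) (w) => a b [c d].
rewrite normrN (le_lt_trans (normc_ge_Re _))// normrM.
by rewrite complexiE normCi mulr1.
Qed.

Lemma open_circle t q p :
  open [set z : R[i] | circle t q p (complex.Re z) (complex.Im z) < 0].
Proof.
apply: (@open_comp _ _ (fun z : R[i] => circle t q p (complex.Re z) (complex.Im z))
   [set x : R | x < 0]); last exact: open_lt.
move=> z _; have F : Filter (nbhs z) by exact: nbhs_filter.
have cRe := @continuous_Re z; have cIm := @continuous_Im z.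
rewrite /circle /continuous_at; apply: (cvgB (V := R)); last exact: cvg_cst.
apply: (cvgD (V := R)); last exact: cvgM.
by apply: (cvgM (K := R)); apply: (cvgB (V := R)) => //; exact: cvg_cst.
Qed.

Lemma closed_ellipse_disc t q :
  closed [set z : R[i] | 0 <= ellipse_disc t q (complex.Re z) (complex.Im z)].
Proof.
apply: (@closed_comp _ _ (fun z : R[i] => ellipse_disc t q (complex.Re z) (complex.Im z))
   [set x : R | 0 <= x]); last exact: closed_ge.
move=> z _; have F : Filter (nbhs z) by exact: nbhs_filter.
have cRe := @continuous_Re z; have cIm := @continuous_Im z.
rewrite /ellipse_disc /continuous_at; apply: (cvgB (V := R)).
  apply: (cvgM (K := R)); apply: (cvgD (V := R)); try exact: cvg_cst.
    by apply: (cvgM (K := R)) => //; exact: cvg_cst.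
  by apply: (cvgM (K := R)) => //; exact: cvg_cst.
apply: (cvgM (K := R)); first exact: cvg_cst.
by apply: (cvgD (V := R)); apply: (cvgM (K := R)).
Qed.

End ellipse.

(** * The numerical range *)

Section operator_norm.
Variables (R : realType) (H K : hilbertType R) (T : {bounded H -> K}).

Let normed_le1 (x : H) : (`|x| <= 1) = (nrm x <= 1).
Proof. by rewrite norm_nrm -lecR. Qed.

Lemma opnorm_le x : nrm (T x) <= opnorm T * nrm x.
Proof.
have [->|x0] := eqVneq x 0; first by rewrite bop0 !nrm0 mulr0.
have n0 := nrm_gt0 x0.
have [M M0 hM] := bounded_nrm T.
rewrite -ler_pdivrMr// mulrC.
have -> : (nrm x)^-1 * nrm (T x) = nrm (T ((nrm x)^-1%:C *: x)).
  by rewrite bopZ nrmZ ger0_norm// invr_ge0 ltW.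
apply: ub_le_sup; last first.
  exists ((nrm x)^-1%:C *: x) => //=; rewrite normed_le1 nrmZ.
  by rewrite ger0_norm ?invr_ge0 ?(ltW n0)// mulVf ?gt_eqF.
exists M => _ [y /= y1 <-]; rewrite normed_le1 in y1.
by rewrite (le_trans (hM y))// ler_piMr.
Qed.

Lemma opnorm_ub (M : R) : 0 <= M -> (forall x, nrm (T x) <= M * nrm x) -> opnorm T <= M.
Proof.
move=> M0 hM; apply: ge_sup; first by exists (nrm (T 0)), 0 => //=; rewrite normr0.
move=> _ [y /= y1 <-]; rewrite normed_le1 in y1.
by rewrite (le_trans (hM y))// ler_piMr.
Qed.

End operator_norm.

Lemma nrm_unit (R : realType) (H : hilbertType R) (x : H) : x != 0 ->
  nrm ((nrm x)^-1%:C *: x) = 1.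
Proof.
move=> /nrm_gt0 n0; rewrite nrmZ ger0_norm ?invr_ge0 ?(ltW n0)//.
by rewrite mulVf ?gt_eqF.
Qed.

(** * Operators [D >= 1] with [D - 1] injective *)

Section operator_ge1.
Variables (R : realType) (H : hilbertType R) (D : {bounded H -> H}).
Hypothesis D1 : positive_op (D \- idfun).
Hypothesis kerD1 : forall x, D x = x -> x = 0.
Hypothesis neq0 : exists x : H, x != 0.

Local Notation s := (opnorm D).

Lemma ge1_sym : symmetric_op D.
Proof.
move=> x y; have := positive_op_sym D1 x y; rewrite /= rdotBl rdotBr.
exact: addIr.
Qed.

Lemma ge1_ge x : nrm x ^+ 2 <= rdot (D x) x.
Proof. by have := positive_op_ge0 x D1; rewrite /= rdotBl rdotxx subr_ge0. Qed.

Lemma ge1_pos : positive_op D.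
Proof.
apply: sym_ge0_positive => [|x]; first exact: ge1_sym.
by rewrite (le_trans _ (ge1_ge x))// sqr_ge0.
Qed.

Lemma ell_posP : positive_op (ell D) /\ forall x, ell D (ell D x) = D (D x) - D x.
Proof.
have [|pl ll] := @op_sqrtP R H (D \o (D \- idfun)).
  apply: sym_ge0_positive => [x y|x] /=.
    by rewrite !bopB rdotBl rdotBr !ge1_sym.
  rewrite ge1_sym -[D x in X in rdot _ X](subrK x) rdotDr rdotxx addr_ge0 ?sqr_ge0//.
  exact: positive_op_ge0 D1.
by split => // x; rewrite [LHS]ll /= bopB.
Qed.

Lemma ell_sym : symmetric_op (ell D).
Proof. by apply: positive_op_sym; case: ell_posP. Qed.

Lemma nrm_ell x : nrm (ell D x) ^+ 2 = nrm (D x) ^+ 2 - rdot (D x) x.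
Proof.
by rewrite -!rdotxx ell_sym ell_posP.2 rdotBr -ge1_sym (rdotC x).
Qed.

Lemma ge1_le x : rdot (D x) x <= s * nrm x ^+ 2.
Proof.
rewrite (le_trans (rdot_CS _ _))// expr2 mulrA ler_wpM2r ?nrm_ge0//.
exact: opnorm_le.
Qed.

Lemma ge1_nrm x : nrm (D x) ^+ 2 <= s * rdot (D x) x.
Proof. by apply: positive_op_nrm; [exact: ge1_pos|exact: ge1_le]. Qed.

(** If [s <= 1], the form of [D - 1] vanishes, so [D x = x] for all [x]. Strictness keeps the
    ellipse nondegenerate. *)
Lemma opnorm_gt1 : 1 < s.
Proof.
have [x x0] := neq0; rewrite ltNge; apply/negP => s1; move/negP: x0; apply.
apply/eqP/kerD1/subr0_eq; apply: (positive_op_eq0 (T := D \- idfun)) => //=.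
apply/eqP; rewrite rdotBl rdotxx eq_le !subr_ge0 ge1_ge andbT subr_le0.
by rewrite (le_trans (ge1_le x))// ler_piMl ?sqr_ge0.
Qed.

(** Otherwise the form of [D] is at most [t |x|^2], and [positive_op_nrm] gives
    [|D x|^2 <= t <D x, x> <= t^2 |x|^2], so the norm of [D] is at most [t]. *)
Lemma ge1_approx t : t < s -> exists2 e : H, nrm e = 1 & t < rdot (D e) e.
Proof.
move=> ts; apply: contrapT => h.
have ht x : rdot (D x) x <= t * nrm x ^+ 2.
  have [->|x0] := eqVneq x 0; first by rewrite rdot0r nrm0 expr0n mulr0.
  rewrite leNgt; apply/negP => hx; apply: h; exists ((nrm x)^-1%:C *: x).
    exact: nrm_unit.
  rewrite bopZ rdotZl rdotZr mulrA -expr2 exprVn mulrC.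
  by rewrite ltr_pdivlMr// exprn_gt0// nrm_gt0.
have t0 : 0 <= t.
  have [x x0] := neq0; have n0 : 0 < nrm x ^+ 2 by rewrite exprn_gt0// nrm_gt0.
  rewrite -(pmulr_lge0 _ n0) (le_trans _ (ht x))// (le_trans _ (ge1_ge x))//.
  exact: ltW.
move: ts; rewrite ltNge => /negP; apply; apply: opnorm_ub => // x.
rewrite -(@ler_pXn2r _ 2)// ?nnegrE ?mulr_ge0 ?nrm_ge0//.
rewrite (le_trans (positive_op_nrm ge1_pos ht x))// exprMn [t ^+ 2]expr2 -mulrA.
by rewrite ler_wpM2l.
Qed.

Lemma ge1_eigen x : rdot (D x) x = s * nrm x ^+ 2 -> D x = s%:C *: x.
Proof.
move=> Dx; apply/esym/subr0_eq; apply: (positive_op_eq0 (T := s%:C \*: idfun \- D)) => /=.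
  apply: sym_ge0_positive => [y z|y] /=; first by rewrite rdotBl rdotBr rdotZl rdotZr ge1_sym.
  by rewrite rdotBl rdotZl rdotxx subr_ge0 ge1_le.
by rewrite rdotBl rdotZl rdotxx Dx subrr.
Qed.

Let ell_numK : ell_num s ^+ 2 = s * (s - 1).
Proof. by rewrite sqr_sqrtr//; have := opnorm_gt1; nra. Qed.

(** The eigenvectors are the same. From [ell(D)^2 = D^2 - D] one gets [(D + (s - 1)) (D - s) x = 0]
    in one direction and [(ell(D) + ell(s)) (ell(D) - ell(s)) x = 0] in the other; the left factors
    are injective. *)
Lemma point_spectrum_ell :
  point_spectrum (ell D) (ell_num s)%:C <-> point_spectrum D s%:C.
Proof.
have s1 := opnorm_gt1; split=> -[x x0 hx]; exists x => //.
  have := ell_posP.2 x; rewrite !(hx, bopZ) scalerA -rmorphM/= -expr2 ell_numK => h.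
  apply/subr0_eq/(positive_op_addc_inj (c := s - 1) ge1_pos); first by lra.
  rewrite bopB bopZ scalerBr scalerA -rmorphM/= mulrC h rmorphB scalerBl/= scale1r.
  set a := D (D x); set b := D x; set c := s%:C *: b.
  by rewrite addrACA -opprD [c + (a - b)]addrCA -(addrCA c) subrr.
apply/subr0_eq; apply: (positive_op_addc_inj (c := ell_num s) ell_posP.1).
  by rewrite sqrtr_gt0; nra.
rewrite bopB bopZ ell_posP.2 !(hx, bopZ) scalerBr addrA subrK !scalerA.
rewrite -!rmorphM/= -(expr2 (ell_num s)) ell_numK -!scalerBl -!rmorphB/=.
by rewrite (_ : _ - _ = 0) ?scale0r//; ring.
Qed.

End operator_ge1.

(** * The numerical range of [TQ] and its ellipse *)

Section matched_numerical_range.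
Variables (R : realType) (H : hilbertType R) (Q : {bounded H -> H}).
Variables (U : {bounded cs_type (H5 Q) -> cs_type (H6 Q)})
  (D : {bounded cs_type (H5 Q) -> cs_type (H5 Q)}).
Hypothesis idemQ : op_idempotent Q.
Hypothesis notproj : ~ is_projection Q.
Hypothesis cd : canonical_decomposition U D.

Local Notation m := (matched_proj Q).
Local Notation l := (ell D).
Local Notation s := (opnorm D).
Local Notation TQ := (m \+ (m \o Q)).
Local Notation W := (numerical_range TQ).
Local Notation q := (s * (s - 1)).

Let D1 : positive_op (D \- idfun) := cd_ge1 cd.

Let kerD1 x : D x = x -> x = 0.
Proof.
move=> Dx; have : [set x | (D \- idfun) x = 0] x by rewrite /= Dx subrr.
by rewrite (cd_ker cd).
Qed.

Let symm := matched_sym idemQ.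

Let UK x : adjoint U (U x) = x. Proof. by case: (cd_unitary cd) => + _; exact. Qed.
Let KU x : U (adjoint U x) = x. Proof. by case: (cd_unitary cd) => _; exact. Qed.

Let nrmU x : nrm (U x) = nrm x.
Proof.
apply/eqP; rewrite -(@eqrXn2 _ 2)// ?nrm_ge0//.
by rewrite -!rdotxx adjoint_rdot UK.
Qed.

Let H1Z a x : H1 Q x -> H1 Q (a *: x).
Proof. by move=> /(H1P idemQ)[mx Qx]; apply/(H1P idemQ); rewrite !bopZ mx Qx. Qed.

Let H40 : H4 Q 0. Proof. by split; rewrite /= bop0. Qed.
Let H10 : H1 Q 0. Proof. by apply/(H1P idemQ); rewrite !bop0. Qed.

Let inner_H1_H5 x1 (x5 : cs_type (H5 Q)) : H1 Q x1 -> inner x1 (cs_val x5) = 0.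
Proof.
move=> h; rewrite inner_rdotE (H1_orth_H5 idemQ h (cs_valP' x5)).
by rewrite -[X in _ +i* X]opprK -rdotZi (H1_orth_H5 idemQ (H1Z _ h) (cs_valP' x5)) oppr0.
Qed.

Let inner_H5_H1 x1 (x5 : cs_type (H5 Q)) : H1 Q x1 -> inner (cs_val x5) x1 = 0.
Proof.
move=> h; rewrite inner_rdotE rdotC (H1_orth_H5 idemQ h (cs_valP' x5)).
by rewrite rdotC (H1_orth_H5 idemQ (H1Z _ h) (cs_valP' x5)).
Qed.

Let Q_block v : H1 Q v.1.1.1 -> H4 Q v.1.1.2 ->
  Q (canonical_map_adj v) = canonical_map_adj (canonical_block U D v).
Proof. by move=> h1 h4; rewrite -(cd_block cd h1 h4) canonical_mapK. Qed.

Let mQ_block x1 x4 (x5 : cs_type (H5 Q)) (x6 : cs_type (H6 Q)) : H1 Q x1 -> H4 Q x4 ->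
  m (Q (canonical_map_adj (x1, x4, x5, x6))) =
  x1 + cs_val (D x5 - l (adjoint U x6)).
Proof. by move=> h1 h4; rewrite Q_block// (matched_canonical idemQ). Qed.

Lemma inner_TQ x1 x4 (x5 : cs_type (H5 Q)) (x6 : cs_type (H6 Q)) :
  H1 Q x1 -> H4 Q x4 ->
  let x := canonical_map_adj (x1, x4, x5, x6) in
  inner (TQ x) x = (nrm x1 ^+ 2 + nrm x1 ^+ 2)%:C +
    inner (x5 + (D x5 - l (adjoint U x6))) x5.
Proof.
move=> h1 h4 x; have mx : m x = x1 + cs_val x5 by rewrite (matched_canonical idemQ).
have TE : TQ x = x1 + x1 + cs_val (x5 + (D x5 - l (adjoint U x6))).
  by rewrite -[TQ x]/(m x + m (Q x)) mx mQ_block// addrACA.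
(* [TQ] maps into the range of [m], so only the component [m x = x1 + x5] of the second argument
   counts. *)
have mT : m (TQ x) = TQ x.
  by rewrite -[TQ x]/(m x + m (Q x)) bopD !matched_idem.
have -> : inner (TQ x) x = inner (TQ x) (m x) by rewrite -(rdot_inner symm) mT.
rewrite TE mx; move: (x5 + _) => w; rewrite innerDr !innerDl.
rewrite inner_H1_H5// inner_H5_H1//.
by rewrite !addr0 add0r inner_rdot -rmorphD.
Qed.

Lemma nrm_canonical x1 x4 (x5 : cs_type (H5 Q)) (x6 : cs_type (H6 Q)) :
  H1 Q x1 -> H4 Q x4 ->
  nrm (canonical_map_adj (x1, x4, x5, x6)) ^+ 2 =
  nrm x1 ^+ 2 + nrm x5 ^+ 2 + (nrm x4 ^+ 2 + nrm x6 ^+ 2).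
Proof.
move=> h1 h4; rewrite /canonical_map_adj.
have -> : x1 + x4 + cs_val x5 + cs_val x6 = (x1 + cs_val x5) + (x4 + cs_val x6).
  by rewrite -addrA addrACA.
have m1 : m (x1 + cs_val x5) = x1 + cs_val x5.
  by rewrite bopD (H5_matched idemQ (cs_valP' x5)) (proj1 ((H1P idemQ x1).1 h1)).
have m4 : m (x4 + cs_val x6) = 0.
  by rewrite bopD (H6_matched idemQ (cs_valP' x6)) (proj1 h4) addr0.
rewrite nrmD2 -{2}m1 symm m4 rdot0r mulr0 addr0 !nrmD2.
rewrite (H1_orth_H5 idemQ h1 (cs_valP' x5)) (H4_orth_H6 idemQ h4 (cs_valP' x6)).
by rewrite !mulr0 !addr0.
Qed.

(** If [H5] were zero, so would be [H6] by way of [U], and then [Q = m] would be a projection. *)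
Lemma H5_neq0 : exists x : cs_type (H5 Q), x != 0.
Proof.
apply: contrapT => h; apply: notproj.
have z5 (x : cs_type (H5 Q)) : x = 0.
  by apply: contrapT => /eqP x0; apply: h; exists x.
have z6 (x : cs_type (H6 Q)) : x = 0 by rewrite -(KU x) (z5 (adjoint U x)) bop0.
have Qm x : Q x = m x.
  rewrite -(canonical_mapK idemQ x).
  have [] := canonical_map_mem idemQ x.
  case: (canonical_map Q x) => [[[x1 x4] x5] x6] h1 h4.
  rewrite Q_block// (matched_canonical idemQ)//.
  change (x1 + 0 + cs_val (D x5 - l (adjoint U x6)) +
    cs_val (U (l x5) + U ((idfun \- D) (adjoint U x6))) = x1 + cs_val x5).
  by rewrite (z5 (_ - _)) (z6 (_ + _)) (z5 x5) !addr0.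
split; first exact: idemQ.
by apply: adjoint_uniq => x y; rewrite !Qm symm.
Qed.

Let s1 : 1 < s. Proof. exact: opnorm_gt1 D1 kerD1 H5_neq0. Qed.

Lemma range_cover z : W z ->
  (exists2 p, 0 <= p <= 1 & circle s q p (complex.Re z) (complex.Im z) < 0) \/
  (point_spectrum D s%:C /\
   exists2 p, 0 <= p <= 1 & circle s q p (complex.Re z) (complex.Im z) <= 0).
Proof.
move=> [x /= x1 <-]; rewrite norm_nrm in x1; move/complexI : x1 => x1.
move: x1; rewrite -(canonical_mapK idemQ x).
have [] := canonical_map_mem idemQ x.
case: (canonical_map Q x) => [[[a1 a4] a5] a6] h1 h4 n1.
have := nrm_canonical a5 a6 h1 h4; rewrite n1 => nE.
have := inner_TQ a5 a6 h1 h4; rewrite /= => ->.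
set y := adjoint U a6.
have ny : nrm y = nrm a6 by rewrite -nrmU KU.
have D0 : rdot (D a5) ('i%C *: a5) = 0.
  by have := ge1_pos D1 a5; rewrite lecE -Im_inner => /andP[/eqP->].
pose g := rdot (D a5) a5.
rewrite inner_rdotE !rdotDl !rdotNl D0 rdot_ii rdotxx -/g !add0r.
(* From [ell(D)^2 = D^2 - D] and [|D x|^2 <= s <D x, x>]. *)
have lD : nrm (l a5) ^+ 2 <= (s - 1) * g.
  by rewrite (nrm_ell D1) -/g; have := ge1_nrm D1 a5; rewrite -/g; lra.
have CS : rdot (l y) a5 ^+ 2 + rdot (l y) ('i%C *: a5) ^+ 2 <=
    nrm a6 ^+ 2 * ((s - 1) * g).
  rewrite !(ell_sym D1) bopZ -ny (le_trans (inner_CS _ _))//.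
  by rewrite ler_wpM2l ?sqr_ge0.
have n6 : nrm a6 ^+ 2 <= 1 - (nrm a1 ^+ 2 + nrm a5 ^+ 2).
  by have := sqr_ge0 (nrm a4); lra.
have g0 : nrm a5 ^+ 2 <= g by exact: ge1_ge.
have g1 : g <= s * nrm a5 ^+ 2 by exact: ge1_le.
case: (@circle_cover _ s (nrm a1 ^+ 2) (nrm a5 ^+ 2) g
  (nrm a1 ^+ 2 + nrm a1 ^+ 2 + (nrm a5 ^+ 2 + (g - rdot (l y) a5)))
  (- rdot (l y) ('i%C *: a5)) s1) => //.
- exact: sqr_ge0.
- exact: sqr_ge0.
- by have := sqr_ge0 (nrm a6); lra.
- rewrite sqrrN.
  have -> : nrm a1 ^+ 2 + nrm a1 ^+ 2 + (nrm a5 ^+ 2 + (g - rdot (l y) a5)) -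
    (nrm a1 ^+ 2 + nrm a1 ^+ 2 + nrm a5 ^+ 2 + g) = - rdot (l y) a5 by ring.
  rewrite sqrrN (le_trans CS)// ler_wpM2r// mulr_ge0//; first by have := s1; lra.
  by rewrite (le_trans _ g0)// sqr_ge0.
- by move=> [p p01 hp]; left; exists p; rewrite //= ?add0r.
move=> [n5 gE [p p01 hp]]; right; split; last by exists p; rewrite //= ?add0r.
exists a5; last exact: (ge1_eigen D1).
by apply/eqP => a50; move: n5; rewrite a50 nrm0 expr0n ltxx.
Qed.

(** The vector is [sqrt p e + c U ell(D) e], with value [(1 + t) p - c sqrt p r]; the scalar [c]
    must have [|c|^2 r = 1 - p] and produce [z]. *)
Lemma circle_range (e : cs_type (H5 Q)) z p : nrm e = 1 -> 1 < rdot (D e) e ->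
  0 <= p <= 1 ->
  circle (rdot (D e) e) (nrm (l e) ^+ 2) p (complex.Re z) (complex.Im z) = 0 -> W z.
Proof.
set t := rdot (D e) e; set r := nrm (l e) ^+ 2 => e1 t1 /andP[p0 p1] hz.
have r0 : 0 < r.
  rewrite /r (nrm_ell D1) -/t.
  by have := rdot_CS2 (D e) e; rewrite e1 expr1n mulr1 -/t; nra.
suff [c cn cz] : exists2 c : R[i], nrm (c *: l e) ^+ 2 = 1 - p &
    z = ((1 + t) * p)%:C - c * (Num.sqrt p * r)%:C.
  pose x5 := (Num.sqrt p)%:C *: e; pose x6 := U (c *: l e).
  have sp : Num.sqrt p ^+ 2 = p by rewrite sqr_sqrtr.
  have nx : nrm (canonical_map_adj (0, 0, x5, x6)) = 1.
    apply/eqP; rewrite -(@eqrXn2 _ 2)// ?nrm_ge0//.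
    rewrite nrm_canonical// /x5 /x6 nrmU cn nrm0 nrmZ e1 mulr1.
    by rewrite ger0_norm ?sqrtr_ge0// sp expr0n/= !add0r expr1n addrC subrK.
  have De : inner (D e) e = t%:C.
    by have := ge1_pos D1 e; rewrite lecE -/t inner_rdotE /= => /andP[/eqP-> _].
  exists (canonical_map_adj (0, 0, x5, x6)).
    exact: etrans (norm_nrm _) (congr1 (fun a => a%:C) nx).
  rewrite inner_TQ// nrm0 expr0n addr0 add0r /x6 UK /x5 !bopZ cz.
  rewrite !(innerDl, innerNl, innerZl) !innerZr De (rdot_inner (ell_sym D1)).
  have pE : p%:C = (Num.sqrt p)%:C ^+ 2 :> R[i] by rewrite -rmorphXn sp.
  rewrite !inner_rdot -/r e1 expr1n !(rmorphD, rmorphM)/= pE rmorph1.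
  by move: (Num.sqrt p)%:C r%:C t%:C => a b d; ring.
(* When [p = 0] the point is the origin, and any [c] of the right modulus will do; otherwise the
   value determines [c], and the circle equation gives its modulus. *)
have [p00|pn] := eqVneq p 0.
  exists (Num.sqrt r)^-1%:C.
    rewrite nrmZ exprMn real_normK ?num_real// exprVn sqr_sqrtr ?(ltW r0)//.
    by rewrite mulVf ?gt_eqF// p00 subr0.
  rewrite p00 sqrtr0 mul0r mulr0 mulr0 subr0; move: hz; rewrite p00 /circle => hz.
  by case: (z) hz => a b /= hz; congr (_ +i* _); nra.
have p_gt0 : 0 < p by rewrite lt0r pn.
have sp0 : 0 < Num.sqrt p by rewrite sqrtr_gt0.
pose d := ((1 + t) * p)%:C - z.
have dn : complex.Re `|d| ^+ 2 = p * (1 - p) * r.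
  move: hz; rewrite /d /circle; case: (z) => a b /= hz.
  rewrite sqr_sqrtr ?addr_ge0 ?sqr_ge0//; lra.
exists (d / (Num.sqrt p * r)%:C); last first.
  rewrite divfK ?opprB; first by rewrite addrC subrK.
  by rewrite fmorph_eq0 mulf_neq0 ?gt_eqF.
rewrite nrm_scale exprMn -/r.
have -> : complex.Re `|d / (Num.sqrt p * r)%:C| = complex.Re `|d| / (Num.sqrt p * r).
  rewrite -fmorphV normrM.
  have -> : `|(Num.sqrt p * r)^-1%:C| = (Num.sqrt p * r)^-1%:C.
    by rewrite ger0_norm// ler0c invr_ge0 mulr_ge0 ?ltW.
  by rewrite normc_def /= mulr0 subr0.
rewrite expr_div_n dn exprMn sqr_sqrtr//; field.
by rewrite pn gt_eqF.
Qed.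

(** A strictly interior point leaves room to replace [s], which may not be attained, by [<D e, e>]
    for a unit [e] nearly attaining it. *)
Lemma open_ellipse_range z p : 0 <= p <= 1 ->
  circle s q p (complex.Re z) (complex.Im z) < 0 -> W z.
Proof.
move=> p01 hz; have [t0 t0s h] := circle_approx s1 p01 hz.
have [|e e1] := ge1_approx D1 H5_neq0 (t := Num.max t0 1).
  by rewrite gt_max t0s s1.
rewrite gt_max => /andP[t0e t1].
have les : rdot (D e) e <= s by have := ge1_le D e; rewrite e1 expr1n mulr1.
have leq : rdot (D e) e * (rdot (D e) e - 1) <= nrm (l e) ^+ 2.
  rewrite (nrm_ell D1); have := rdot_CS2 (D e) e; rewrite e1 expr1n mulr1; lra.
have q0 : 0 < nrm (l e) ^+ 2 by apply: lt_le_trans leq; nra.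
have [p' p'01 hp'] := disc_circle q0 (circle_disc_ge0 (ltW q0) (h _ _ t0e t1 les leq)).
exact: circle_range hp'.
Qed.

Lemma eigen_ellipse_range : point_spectrum D s%:C ->
  W = [set z | 0 <= ellipse_disc s q (complex.Re z) (complex.Im z)].
Proof.
have q0 : 0 < q by have := s1; nra.
move=> [x x0 Dx]; apply/seteqP; split => z.
  by case/range_cover => [[p _ /ltW hp]|[_ [p _ hp]]]; exact: circle_disc_ge0 (ltW q0) hp.
pose e := (nrm x)^-1%:C *: x.
have e1 : nrm e = 1 by exact: nrm_unit.
have De : D e = s%:C *: e by rewrite /e bopZ Dx !scalerA mulrC.
have te : rdot (D e) e = s by rewrite De rdotZl rdotxx e1 expr1n mulr1.
have qe : nrm (l e) ^+ 2 = q.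
  rewrite (nrm_ell D1) te De nrmZ e1 mulr1 real_normK ?num_real//; ring.
move=> /= /(disc_circle q0)[p p01 hp].
by apply: (circle_range e1 _ p01); rewrite te ?qe.
Qed.

Lemma closure_range_disc z : closure W z ->
  0 <= ellipse_disc s q (complex.Re z) (complex.Im z).
Proof.
have q0 : 0 < q by have := s1; nra.
move=> Wz; apply: (closed_ellipse_disc (t := s) (q := q)); apply: closure_subset Wz => w.
by case/range_cover => [[p _ /ltW hp]|[_ [p _ hp]]]; exact: circle_disc_ge0 (ltW q0) hp.
Qed.

(* The boundary point is the rightmost real point of the closure. *)
Lemma boundary_range_neq0 : boundary (closure W) !=set0.
Proof.
have q0 : 0 < q by have := s1; nra.
pose S := [set r : R | closure W r%:C].
have hS : has_sup S.
  split.
    have [p p01 hp] := circle_origin s1.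
    by exists 0; apply: subset_closure; exact: (@open_ellipse_range 0%:C _ p01 hp).
  (* Beyond this bound [r] exceeds every centre [(1 + s) p] by more than [1 + q], while squared
     radii are at most [q]. *)
  exists (2 + s + q) => r /closure_range_disc/(disc_circle q0)[p /andP[p0 p1]] /=.
  rewrite /circle expr0n addr0 => hp; rewrite leNgt; apply/negP => rs.
  have h1 : 1 + q < r - (1 + s) * p by have := s1; nra.
  have h2 : q * (p * (1 - p)) <= q by nra.
  by nra.
have ball_real (a b d : R) : `|a - b| < d -> ball (a%:C : R[i]) d%:C b%:C.
  move=> abd; rewrite -ball_normE /= -rmorphB/= normc_def /= expr0n addr0.
  by rewrite sqrtr_sqr ltcR.
have gt0_real (d : R[i]) : 0 < d -> d = (complex.Re d)%:C.
  by move=> d0; rewrite RRe_real// gtr0_real.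
exists (sup S)%:C; split.
  move=> B /nbhs_ballP[d /= d0 hB].
  have e0 : 0 < complex.Re d by rewrite -ltcR -gt0_real.
  have [r Sr supr] := sup_adherent e0 hS; exists r%:C; split => //.
  apply: hB; rewrite (gt0_real d)//; apply: ball_real.
  by rewrite ger0_norm ?subr_ge0 ?ub_le_sup//; [lra|case: hS].
rewrite /interior => /nbhs_ballP[d /= d0 hB].
have e0 : 0 < complex.Re d by rewrite -ltcR -gt0_real.
have : S (sup S + complex.Re d / 2).
  apply: hB; rewrite (gt0_real d)//; apply: ball_real.
  by rewrite opprD addNKr normrN ger0_norm ?divr_ge0 ?ltW//; lra.
move=> /(ub_le_sup hS.2); lra.
Qed.

End matched_numerical_range.

Theorem theorem4p14 (R : realType) (H : hilbertType R)
    (Q : {bounded H -> H})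
    (U : {bounded cs_type (H5 Q) -> cs_type (H6 Q)})
    (D : {bounded cs_type (H5 Q) -> cs_type (H5 Q)}) :
  (exists x : H, x != 0) ->
  op_idempotent Q -> ~ is_projection Q ->
  canonical_decomposition U D ->
  let TQ : {bounded H -> H} := matched_proj Q \+ (matched_proj Q \o Q) in
  let W := numerical_range TQ in
  [<-> closed W;
       boundary (closure W) `<=` W;
       exists2 z, boundary (closure W) z & W z;
       point_spectrum (ell D) (ell_num (opnorm D))%:C;
       point_spectrum D (opnorm D)%:C].
Proof.
move=> _ idemQ notproj cd TQ W.
have kerD x : D x = x -> x = 0.
  move=> Dx; have : [set x | (D \- idfun) x = 0] x by rewrite /= Dx subrr.
  by rewrite (cd_ker cd).
have spec := point_spectrum_ell (cd_ge1 cd) kerD (H5_neq0 idemQ notproj cd).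
tfae.
- by move=> cW z [+ _]; rewrite -(closure_id W).1// -(closure_id W).1.
- by have [z bz] := boundary_range_neq0 idemQ notproj cd => /(_ _ bz) Wz; exists z.
- move=> [z [_ nz] Wz]; apply/spec.
  (* A point of an open disc has a neighbourhood inside [W], so it is not a boundary point; only the
     eigenvalue alternative remains. *)
  case: (range_cover idemQ notproj cd Wz) => [[p p01 hp]|[//]]; case: nz.
  have := @open_circle R (opnorm D) (opnorm D * (opnorm D - 1)) p.
  rewrite openE => /(_ z hp); apply: filterS => w hw; apply: subset_closure.
  exact: (open_ellipse_range idemQ notproj cd p01 hw).
- by move/spec.
- move=> /(eigen_ellipse_range idemQ notproj cd) WE.
  rewrite /W WE; exact: closed_ellipse_disc.
Qed.
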